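(* Let $N$ be odd. Define $$q_{2j}(x)=x^{2j},\quad q_{2j+1}(x)=x^{N-1-2j}\quad\text{for }0\le2j<(N-1)/2,$$ $$q_{2j}(x)=x^{2j+1},\quad q_{2j+1}(x)=x^{N-1-(2j+1)}\quad\text{for }(N-1)/2\le2j<N-1,$$ $$q_{N-1}(x)=x^{(N-1)/2}+\sum_{j=0}^{(N-1)/2-1}\left(\frac{\langle q_{2j+1},x^{(N-1)/2}\rangle_S}{\hat\alpha^{\mathrm{odd}}_j+\hat\beta^{\mathrm{odd}}_j}\,q_{2j}(x)-\frac{\langle q_{2j},x^{(N-1)/2}\rangle_S}{\hat\alpha^{\mathrm{odd}}_j+\hat\beta^{\mathrm{odd}}_j}\,q_{2j+1}(x)\right),$$ where $\hat\alpha_j^{\mathrm{odd}}:=\langle q_{2j},q_{2j+1}\rangle_\alpha$, $\hat\beta_j^{\mathrm{odd}}:=\langle q_{2j},q_{2j+1}\rangle_\beta$ and $\langle\cdot,\cdot\rangle_S=\langle\cdot,\cdot\rangle_\alpha+\langle\cdot,\cdot\rangle_\beta$ is the skew inner product of the context. Then these polynomials are skew-orthogonal: for $0\le j,l\le(N-1)/2-1$, $$\langle q_{2j},q_{2l}\rangle_S=\langle q_{2j+1},q_{2l+1}\rangle_S=0,\qquad\langle q_{2j},q_{2l+1}\rangle_S=-\langle q_{2l+1},q_{2j}\rangle_S=\delta_{j,l}(\hat\alpha^{\mathrm{odd}}_j+\hat\beta^{\mathrm{odd}}_j),$$ and $\langle q_{s-1},q_{N-1}\rangle_S=\langle q_{N-1},q_{s-1}\rangle_S=0$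 for all $1\le s\le N$. Moreover, for $0\le2j<(N-1)/2$, $$\hat\alpha_j^{\mathrm{odd}}=\frac{2\pi}{N-1-4j}\frac{\Gamma((N+1)/2)}{\Gamma(N/2+1)},\qquad\hat\beta_j^{\mathrm{odd}}=\frac{2\sqrt\pi}{N-1-4j}\left(2^N\frac{\Gamma(2j+1)\Gamma(N-2j)}{\Gamma(N+1)}-\sqrt\pi\frac{\Gamma((N+1)/2)}{\Gamma(N/2+1)}\right);$$ for $(N-1)/2\le2j<N-1$, $$\hat\alpha_j^{\mathrm{odd}}=\frac{2\pi}{N-3-4j}\frac{\Gamma((N+1)/2)}{\Gamma(N/2+1)},\qquad\hat\beta_j^{\mathrm{odd}}=\frac{2\sqrt\pi}{N-3-4j}\left(2^N\frac{\Gamma(2j+2)\Gamma(N-2j-1)}{\Gamma(N+1)}-\sqrt\pi\frac{\Gamma((N+1)/2)}{\Gamma(N/2+1)}\right);$$ and $$\bar\nu_N:=\frac1{\sqrt2}\int_0^{2\pi}\tau(e^{i\theta})\,q_{N-1}(e^{i\theta})\,d\theta=\pi\sqrt{\frac{\Gamma((N+1)/2)}{\Gamma(N/2+1)}}.$$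
   Context: For $N$ odd put $$\tau(x)=x^{-(N-1)/2}\left[\frac1{\sqrt\pi}\int_{\left||x|^{-1}-|x|\right|/2}^\infty\frac{dt}{(1+t^2)^{N/2+1}}\right]^{1/2}.$$ For polynomials $p,q$, with $e_a=e^{i\theta_a}$ and $\Omega$ the open unit disk ($dw$ planar Lebesgue measure), $$\langle p,q\rangle_\alpha=-\frac i2\int_0^{2\pi}d\theta_1\,\tau(e_1)\int_0^{2\pi}d\theta_2\,\tau(e_2)\,p(e_1)q(e_2)\,\mathrm{sgn}(\theta_2-\theta_1),$$ $$\langle p,q\rangle_\beta=\int_\Omega dw\,\tau(w)\,\tau\!\Big(\frac1{\bar w}\Big)\frac1{|w|^2}\left(p(w)\,q\Big(\frac1{\bar w}\Big)-q(w)\,p\Big(\frac1{\bar w}\Big)\right),$$ and $\langle p,q\rangle_S=\langle p,q\rangle_\alpha+\langle p,q\rangle_\beta$. *)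

(* Defs.v *)
From HB Require Import structures.
From mathcomp Require Import all_boot all_order all_algebra.
From mathcomp Require Import all_classical all_reals all_analysis.
From mathcomp.real_closed Require Import complex.
From mathcomp Require Import zify.

Set Implicit Arguments.
Unset Strict Implicit.
Unset Printing Implicit Defensive.

Import Order.TTheory GRing.Theory Num.Theory.
Import numFieldNormedType.Exports.

Local Open Scope classical_set_scope.
Local Open Scope ring_scope.
Local Open Scope complex_scope.

(* The library only integrates real-valued functions: a complex integral is
   taken componentwise. *)
Definition Cintegral d (T : measurableType d) (R : realType)
    (mu : {measure set T -> \bar R}) (D : set T) (f : T -> R[i]) : R[i] :=
  (\int[mu]_(x in D) complex.Re (f x)) +i*
  (\int[mu]_(x in D) complex.Im (f x)).

Definition Gamma (R : realType) (x : R) : R :=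
  \int[@lebesgue_measure R]_(t in `]0, +oo[) (t `^ (x - 1) * expR (- t)).

Section SkewProducts.
Variables (R : realType) (N : nat).
Local Notation mu := (@lebesgue_measure R).

Definition e_ (theta : R) : R[i] := cos theta +i* sin theta.

(* For odd N, (N.-1)./2 is exactly (N - 1) / 2. *)
Definition tau (x : R[i]) : R[i] :=
  let r := Normc.normc x in
  x ^- (N.-1)./2 *
  (Num.sqrt ((Num.sqrt pi)^-1 *
     \int[mu]_(t in `[`|r^-1 - r| / 2, +oo[)
        ((1 + t ^+ 2) `^ (N%:R / 2 + 1))^-1))%:C.

Definition skew_alpha (p q : {poly R[i]}) : R[i] :=
  - ('i / 2) *
  Cintegral mu `[0, 2 * pi] (fun theta1 => tau (e_ theta1) *
    Cintegral mu `[0, 2 * pi] (fun theta2 => tau (e_ theta2) *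
      p.[e_ theta1] * q.[e_ theta2] * (Num.sg (theta2 - theta1))%:C)).

Definition skew_beta (p q : {poly R[i]}) : R[i] :=
  Cintegral (mu \x mu)%E [set z : R * R | Normc.normc (z.1 +i* z.2) < 1]
    (fun z => let w := z.1 +i* z.2 in let w' := (w^*)^-1 in
      tau w * tau w' * ((Normc.normc w ^+ 2)^-1)%:C *
      (p.[w] * q.[w'] - q.[w] * p.[w'])).

Definition skew_S (p q : {poly R[i]}) : R[i] := skew_alpha p q + skew_beta p q.

(* The monomials q_0, ..., q_{N-2}. *)
Definition qmon (k : nat) : {poly R[i]} :=
  let j := k./2 in
  let a := if (j.*2 < (N.-1)./2)%N then j.*2 else j.*2.+1 in
  if odd k then 'X^(N.-1 - a) else 'X^a.

Definition alphahat (j : nat) : R[i] :=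
  skew_alpha (qmon j.*2) (qmon j.*2.+1).
Definition betahat (j : nat) : R[i] :=
  skew_beta (qmon j.*2) (qmon j.*2.+1).

Definition qlast : {poly R[i]} :=
  'X^((N.-1)./2) + \sum_(j < (N.-1)./2)
    ((skew_S (qmon j.*2.+1) 'X^((N.-1)./2) / (alphahat j + betahat j))
        *: qmon j.*2
     - (skew_S (qmon j.*2) 'X^((N.-1)./2) / (alphahat j + betahat j))
        *: qmon j.*2.+1).

(* Only the indices k <= N - 1 are meaningful. *)
Definition q_ (k : nat) : {poly R[i]} :=
  if (k < N.-1)%N then qmon k else qlast.

Definition nubar : R[i] :=
  ((Num.sqrt 2)^-1)%:C *
  Cintegral mu `[0, 2 * pi] (fun theta => tau (e_ theta) * (q_ N.-1).[e_ theta]).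

Lemma q_even_low j : (j.*2 < (N.-1)./2)%N -> q_ j.*2 = 'X^(j.*2).
Proof. by move=> jm; rewrite /q_ ifT ?/qmon ?odd_double ?doubleK ?jm; last lia. Qed.

Lemma q_odd_low j : (j.*2 < (N.-1)./2)%N ->
  q_ j.*2.+1 = 'X^(N - 1 - j.*2).
Proof.
move=> jm; rewrite /q_ ifT; last by lia.
by rewrite /qmon /= odd_double /= uphalf_double jm subn1.
Qed.

Lemma q_even_high j : ((N.-1)./2 <= j.*2 < N.-1)%N ->
  q_ j.*2 = 'X^(j.*2.+1).
Proof.
move=> /andP[mj jN]; rewrite /q_ jN.
by rewrite /qmon odd_double doubleK ltnNge mj.
Qed.

Lemma q_odd_high j : odd N -> ((N.-1)./2 <= j.*2 < N.-1)%N ->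
  q_ j.*2.+1 = 'X^(N - 1 - j.*2.+1).
Proof.
move=> oN /andP[mj jN]; rewrite /q_ ifT; last by lia.
by rewrite /qmon /= odd_double /= uphalf_double ltnNge mj subn1.
Qed.

Lemma q_last : q_ N.-1 = qlast.
Proof. by rewrite /q_ ltnn. Qed.

End SkewProducts.

(* Main.v *)
(* Both skew products are bilinear in the coefficients of the two polynomials,
   so everything reduces to their values on monomials x^a, x^b with
   0 <= a, b <= N - 1 = 2m.  On the unit circle tau(e^{it}) is a constant times
   e^{-imt}, and the alpha integrals are elementary Fourier integrals.  For beta,
   the angular integral over the disc vanishes unless a + b = 2m.  The substitution
   u = 1 - t / sqrt(1 + t^2) turns the tail integral in tau into the polynomial
   K(z), the integral of u^m (2 - u)^m over [0, z], taken at z = 2s / (1 + s) with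
   s = |w|^2; the remaining radial integral then has an explicit primitive, whose
   value at s = 1 is a beta integral.  Hence the combined kernel is antisymmetric
   and vanishes unless a + b = 2m or one of a, b equals m.  The monomials q_k pair
   up exponents with sum 2m, and the correction terms of q_{N-1} remove its
   products with each pair. *)
Require Import Defs.
From HB Require Import structures.
From mathcomp Require Import all_boot all_order all_algebra.
From mathcomp Require Import all_classical all_reals all_analysis.
From mathcomp Require Import measurable_realfun.
From mathcomp.real_closed Require Import complex.
From mathcomp Require Import zify ring lra.

Set Implicit Arguments.
Unset Strict Implicit.
Unset Printing Implicit Defensive.

Import Order.TTheory GRing.Theory Num.Theory.
Import numFieldNormedType.Exports.

Local Open Scope classical_set_scope.
Local Open Scope ring_scope.
Local Open Scope complex_scope.

(** * Integrals on the line *)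

Section RealIntegrals.
Variable R : realType.
Local Notation mu := (@lebesgue_measure R).

(** The square root in tau never has to be integrated. In the disc integral w is paired with
    1/conj(w), and the radicand depends on r = |w| only through |1/r - r|, so both radicands agree
    and the roots multiply out; on the circle the radicand is constant. The radial integrals enter
    only through the difference of the moments of exponents 2a and 2b with a + b = 2m. Since a - m
    and b - m are opposite, the differential equation of the radial profile gives this difference an
    explicit primitive. With B(a,b) the integral of x^a (2 - x)^b over [0,2], its value at the
    endpoint is B(m,m) - B(a,b). The term B(m,m) cancels against the circle contribution, so x^a and
    x^b pair to sqrt(pi) B(a,b) / (m - a). This is nonzero, which makes the divisions in q_(N-1)
    meaningful. The formula excludes a = m: the exponent m would be its own partner. The exponents
    of q_0, ..., q_(N-2) therefore step over m, which is the origin of the two ranges of j. *)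

Lemma is_derive_monomial (n : nat) (x : R) :
  is_derive x (1 : R) (fun x => x ^+ n.+1) (n.+1%:R * x ^+ n).
Proof.
apply: DeriveDef; first exact: exprn_derivable.
by rewrite exp_derive /GRing.scale/= mulr1 mulr_natl.
Qed.

Lemma Rintegral_FTC2 (F f : R -> R) (a b : R) : a <= b ->
  {in `[a, b], forall x : R, is_derive x (1 : R) F (f x)} ->
  {in `[a, b], continuous f} ->
  \int[mu]_(x in `[a, b]) f x = F b - F a.
Proof.
move=> ab dF cf; case: (ltgtP a b) ab => // [ab _|-> _]; last first.
  by rewrite set_itv1 Rintegral_set1 subrr.
have cF x : x \in `[a, b] -> {for x, continuous F}.
  move=> /dF dFx; apply: differentiable_continuous.
  by apply/derivable1_diffP; exact: ex_derive.
rewrite /Rintegral (@continuous_FTC2 _ f F a b) //.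
- by apply: continuous_in_subspaceT => x /[!inE]; exact: cf.
- split.
  + by move=> x xab; have [] := dF x (subset_itv_oo_cc xab).
  + by apply: cvg_at_right_filter; apply: cF; rewrite in_itv/= lexx ltW.
  + by apply: cvg_at_left_filter; apply: cF; rewrite in_itv/= lexx ltW.
- move=> x xab; rewrite derive1E; apply: derive_val.
  by apply: dF; exact: subset_itv_oo_cc xab.
Qed.

Lemma ge0_integral_FTC2y (F f : R -> R) (a l : R) :
  (forall x : R, a <= x -> is_derive x (1:R) F (f x)) ->
  (forall x, a <= x -> {for x, continuous f}) ->
  (forall x, a <= x -> 0 <= f x) ->
  F x @[x --> +oo] --> l ->
  (\int[mu]_(x in `[a, +oo[) (f x)%:E = (l - F a)%:E)%E.
Proof.
move=> dF cf f0 Fl.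
rewrite (@ge0_continuous_FTC2y _ f F a l) ?EFinB//.
- apply: continuous_in_subspaceT => x; rewrite inE/= in_itv/= andbT; exact: cf.
- by move=> x /ltW /dF dFx; exact: ex_derive.
- apply: cvg_at_right_filter; apply: differentiable_continuous.
  by apply/derivable1_diffP; have [] := dF a (lexx a).
- by move=> x; rewrite in_itv/= andbT => /ltW /dF dFx; rewrite derive1E derive_val.
Qed.

(** Tonelli's theorem for the density phi(s) w(t) on the region psi(s) < t. It plays the role of
    integration by parts, with no boundary term and no integrability to check. *)
Lemma ge0_tonelli_layer (phi w psi : R -> R) :
  measurable_fun setT phi -> measurable_fun setT w -> measurable_fun setT psi ->
  (forall x, 0 <= phi x) -> (forall x, 0 <= w x) ->
  (\int[mu]_t ((w t)%:E * \int[mu]_(s in [set s | psi s < t]%R) (phi s)%:E) =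
   \int[mu]_s ((phi s)%:E * \int[mu]_(t in [set t | psi s < t]%R) (w t)%:E))%E.
Proof.
move=> mphi mw mpsi phi0 w0.
pose f (z : R * R) : \bar R := (phi z.1 * w z.2 * \1_[set z | psi z.1 < z.2] z)%:E.
have mS : measurable [set z : R * R | psi z.1 < z.2].
  have -> : [set z : R * R | psi z.1 < z.2] =
     (fun z : R * R => psi z.1 < z.2) @^-1` [set true].
    by apply/seteqP; split => z /=; case: (psi z.1 < z.2).
  rewrite -[_ @^-1` _]setTI; apply: measurable_fun_ltr => //.
  by apply: measurableT_comp.
have mf : measurable_fun setT f.
  apply/measurable_EFinP; apply: measurable_funM.
    by apply: measurable_funM; apply: measurableT_comp.
  exact: measurable_indic.
have f0 z : (0 <= f z)%E.
  by rewrite lee_fin !mulr_ge0 // indicE ler0n.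
(* Turns a section of the region into an integral over a set; c is the weight of the other
   variable. *)
have mI (g : R -> R) (S : set R) : measurable S -> measurable_fun setT g ->
    (forall x, 0 <= g x) -> forall c, 0 <= c ->
    (\int[mu]_x (c * (g x * \1_S x))%:E = c%:E * \int[mu]_(x in S) (g x)%:E)%E.
  move=> mS' mg g0 c c0; rewrite -ge0_integralZl_EFin//=; last 2 first.
  - by move=> x _; rewrite lee_fin.
  - by apply/measurable_EFinP; exact: measurable_funS mg.
  rewrite [RHS]integral_mkcond; apply: eq_integral => x _.
  rewrite patchE indicE; case: ifP => _ /=; first by rewrite mulr1 EFinM.
  by rewrite mulr0 mulr0.
have mSt t : measurable [set s | psi s < t].
  have -> : [set s | psi s < t] = psi @^-1` `]-oo, t[.
    by apply/seteqP; split => s /=; rewrite in_itv.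
  by rewrite -[_ @^-1` _]setTI; apply: mpsi.
have mSs s : measurable [set t | psi s < t].
  have -> : [set t | psi s < t] = `]psi s, +oo[%classic.
    by apply/seteqP; split => t /=; rewrite in_itv/= ?andbT.
  exact: measurable_itv.
transitivity (\int[mu]_t \int[mu]_s f (s, t))%E.
  apply: eq_integral => t _; rewrite -mI//; apply: eq_integral => s _.
  by rewrite /f mulrA [phi _ * _]mulrC !indicE.
transitivity (\int[mu]_s \int[mu]_t f (s, t))%E.
  by rewrite -(@fubini_tonelli _ _ _ _ R mu mu f mf f0).
apply: eq_integral => s _; rewrite -mI//; apply: eq_integral => t _.
by rewrite /f mulrA !indicE.
Qed.

End RealIntegrals.

(** * Gamma at integers and half-integers *)

Section GammaValues.
Variable R : realType.
Local Notation mu := (@lebesgue_measure R).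
Local Notation Rp := (`[0%R, +oo[%classic : set R).

(** The half-open interval matches the strict inequality psi(s) < t that cuts out the layer
    region. *)
Lemma integral_monomial_co (n : nat) (t : R) : 0 <= t ->
  (\int[mu]_(s in `[0%R, t[) (n.+1%:R * s ^+ n)%:E = (t ^+ n.+1)%:E)%E.
Proof.
move=> t0.
rewrite integral_itv_bndo_bndc; last first.
  apply/measurable_EFinP; exact: measurable_funM.
have dF := @is_derive_monomial R n.
have cf (x : R) : {for x, continuous (fun s : R => n.+1%:R * s ^+ n)}.
  by apply: cvgM; [exact: cvg_cst|exact: exprn_continuous].
rewrite -[LHS]fineK; last first.
  apply: integrable_fin_num => //; apply: continuous_compact_integrable.
    exact: segment_compact.
  by apply: continuous_subspaceT => x; exact: cf.
congr EFin; rewrite -/(Rintegral _ _ _).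
rewrite (@Rintegral_FTC2 _ (fun x => x ^+ n.+1)) ?expr0n ?subr0//.
by move=> x _; exact: cf.
Qed.

(* Layer-cake form of integration by parts for the weight [w] with tail [W];
   [r] is the inverse of [psi] on the half-line. *)
Lemma layer_moment (n : nat) (psi r w W : R -> R) :
  measurable_fun setT w -> measurable_fun setT psi ->
  (forall t : R, 0 <= t -> 0 <= w t) ->
  (forall t : R, 0 <= t -> 0 <= r t) ->
  (forall s t : R, 0 <= s -> 0 <= t -> (psi s < t) = (s < r t)) ->
  (forall s : R, 0 <= s -> 0 <= psi s) ->
  (forall s : R, 0 <= s ->
    (\int[mu]_(t in `]psi s, +oo[) (w t)%:E = (W s)%:E)%E) ->
  (\int[mu]_(t in Rp) (w t * r t ^+ n.+1)%:E =
   \int[mu]_(s in Rp) (n.+1%:R * (s ^+ n * W s))%:E)%E.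
Proof.
move=> mw mpsi w0 r0 psir psi0 wW.
have mRp : measurable Rp by exact: measurable_itv.
pose phi := (fun s : R => n.+1%:R * s ^+ n) \_ Rp.
have mphi : measurable_fun setT phi.
  apply/(measurable_restrictT _ _).1 => //; exact: measurable_funM.
have mw' : measurable_fun setT (w \_ Rp).
  by apply/(measurable_restrictT _ _).1 => //; exact: measurable_funS mw.
have phi0 x : 0 <= phi x.
  rewrite /phi patchE; case: ifPn => //; rewrite inE/= in_itv/= andbT => x0.
  by rewrite mulr_ge0 ?exprn_ge0.
have w'0 x : 0 <= (w \_ Rp) x.
  by rewrite patchE; case: ifPn => //; rewrite inE/= in_itv/= andbT => /w0.
have := ge0_tonelli_layer mphi mw' mpsi phi0 w'0.
set X := (X in X = _ -> _); set Y := (Y in _ = Y -> _) => XY.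
transitivity X.
  rewrite /X integral_mkcond; apply: eq_integral => t _.
  rewrite patchE [in RHS]patchE; case: ifPn => [|_]; last by rewrite mul0e.
  rewrite inE/= in_itv/= andbT => t0; rewrite EFinM; congr (_ * _)%E.
  rewrite -integral_monomial_co ?r0//.
  rewrite integral_mkcond [RHS]integral_mkcond; apply: eq_integral => s _.
  rewrite !patchE /phi patchE !mem_setE/= !in_itv/=.
  case: (leP 0 s) => s0 /=; last by case: ifP.
  rewrite -psir//; have -> // : (s \in [set s | psi s < t]) = (psi s < t).
rewrite XY /Y [RHS]integral_mkcond; apply: eq_integral => s _.
rewrite [in LHS]/phi patchE [in RHS]patchE; case: ifPn => [|_]; last by rewrite mul0e.
rewrite inE/= in_itv/= andbT => s0; rewrite mulrA [in RHS]EFinM; congr (_ * _)%E.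
rewrite -wW// integral_mkcond [RHS]integral_mkcond; apply: eq_integral => t _.
have e : (t \in [set t | psi s < t]) = (psi s < t).
  by apply/idP/idP => [/set_mem|/mem_set].
rewrite !patchE e !mem_setE/= !in_itv/= !andbT.
case: ifP => // st; rewrite ifT// (le_trans (psi0 _ s0))//; exact: ltW.
Qed.

Let mRp : measurable Rp. Proof. exact: measurable_itv. Qed.

Lemma integral_tail_expRN (s : R) :
  (\int[mu]_(t in `]s, +oo[) (expR (- t))%:E = (expR (- s))%:E)%E.
Proof.
rewrite integral_itv_obnd_cbnd; last first.
  by apply/measurable_EFinP; apply: measurableT_comp => //; exact: measurableT_comp.
have dF (x : R) : is_derive x (1 : R) (fun x => - expR (- x)) (expR (- x)).
  by apply: is_derive_eq; rewrite /GRing.scale/= mulrN1 opprK.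
rewrite (@ge0_integral_FTC2y _ (fun x => - expR (- x)) _ s 0 (fun x _ => dF x)).
- by rewrite sub0r opprK.
- move=> x _; apply: continuous_comp; last exact: continuous_expR.
  exact: cvgN.
- by move=> x _; exact: expR_ge0.
- by rewrite -oppr0; apply: cvgN; exact: cvgr_expR.
Qed.

Lemma integral_tail_gauss (s : R) : 0 <= s ->
  (\int[mu]_(t in `]s, +oo[) (2 * t * expR (- t ^+ 2))%:E = (expR (- s ^+ 2))%:E)%E.
Proof.
move=> s0; rewrite integral_itv_obnd_cbnd; last first.
  apply/measurable_EFinP; apply: measurable_funM.
    exact: measurable_funM.
  exact: measurable_funTS (@measurable_gauss_fun R).
have dF (x : R) : is_derive x (1 : R) (fun x => - expR (- x ^+ 2))
    (2 * x * expR (- x ^+ 2)).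
  apply: is_derive_eq.
  by rewrite /GRing.scale/= mulr1; ring.
rewrite (@ge0_integral_FTC2y _ (fun x => - expR (- x ^+ 2)) _ s 0 (fun x _ => dF x)).
- by rewrite sub0r opprK.
- move=> x _; apply: cvgM; last exact: continuous_gauss_fun.
  by apply: cvgM; [exact: cvg_cst|exact: cvg_id].
- by move=> x sx; rewrite !mulr_ge0 ?expR_ge0// (le_trans s0).
- by rewrite -oppr0; apply: cvgN; exact: cvg_gauss_fun.
Qed.

(** Both moments stay in [\bar R]: the recurrences then hold without any integrability hypothesis,
    and finiteness comes out of the closed forms. *)
Definition exp_moment n : \bar R := (\int[mu]_(t in Rp) (t ^+ n * expR (- t))%:E)%E.
Definition gauss_moment n : \bar R := (\int[mu]_(t in Rp) (t ^+ n * expR (- t ^+ 2))%:E)%E.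

Let measurable_exp_moment n :
  measurable_fun Rp (fun t : R => (t ^+ n * expR (- t))%:E).
Proof.
apply/measurable_EFinP; apply: measurable_funM.
  exact: exprn_measurable.
by apply: measurableT_comp => //; exact: measurableT_comp.
Qed.

Let measurable_gauss_moment n :
  measurable_fun Rp (fun t : R => (t ^+ n * expR (- t ^+ 2))%:E).
Proof.
apply/measurable_EFinP; apply: measurable_funM.
  exact: exprn_measurable.
exact: measurable_funTS (@measurable_gauss_fun R).
Qed.

(** The tail of e^(-t) is e^(-s) itself, so the layer formula sends the moment of order n + 1 to
    that of order n. *)
Lemma exp_momentS n : exp_moment n.+1 = (n.+1%:R%:E * exp_moment n)%E.
Proof.
transitivity (\int[mu]_(t in Rp) (expR (- t) * t ^+ n.+1)%:E)%E.
  by apply: eq_integral => t _; rewrite mulrC.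
rewrite (@layer_moment n id id _ (fun s => expR (- s))) //.
- rewrite -ge0_integralZl_EFin //; last first.
    exact: measurable_exp_moment.
  move=> t; rewrite /= in_itv/= andbT => t0.
  by rewrite lee_fin mulr_ge0 ?exprn_ge0 ?expR_ge0.
- by apply: measurableT_comp => //; exact: measurableT_comp.
- by move=> s _; exact: integral_tail_expRN.
Qed.

(** The weight 2 t e^(-t^2) has tail e^(-s^2); giving it one factor t lowers the order by two in
    all. *)
Lemma gauss_momentSS n :
  (2%:E * gauss_moment n.+2 = n.+1%:R%:E * gauss_moment n)%E.
Proof.
rewrite -ge0_integralZl_EFin //; last 2 first.
- move=> t; rewrite /= in_itv/= andbT => t0.
  by rewrite lee_fin mulr_ge0 ?exprn_ge0 ?expR_ge0.
- exact: measurable_gauss_moment.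
transitivity (\int[mu]_(t in Rp) (2 * t * expR (- t ^+ 2) * t ^+ n.+1)%:E)%E.
  by apply: eq_integral => t _; rewrite -EFinM; congr EFin; rewrite [in LHS]exprS; ring.
rewrite (@layer_moment n id id _ (fun s => expR (- s ^+ 2))) //.
- rewrite -ge0_integralZl_EFin //; last first.
    exact: measurable_gauss_moment.
  move=> t; rewrite /= in_itv/= andbT => t0.
  by rewrite lee_fin mulr_ge0 ?exprn_ge0 ?expR_ge0.
- apply: measurable_funM; first exact: measurable_funM.
  exact: measurable_funTS (@measurable_gauss_fun R).
- by move=> t t0; rewrite !mulr_ge0 ?expR_ge0.
- by move=> s; exact: integral_tail_gauss.
Qed.

(** The change of variable t = s^2, carried out by the layer formula with psi the square and r the
    square root. It leads from half-integer powers of t to Gaussian moments. *)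
Lemma exp_moment_sqrt n :
  (\int[mu]_(t in Rp) (expR (- t) * Num.sqrt t ^+ n.+1)%:E =
   n.+1%:R%:E * gauss_moment n)%E.
Proof.
rewrite (@layer_moment n (fun s => s ^+ 2) Num.sqrt _ (fun s => expR (- s ^+ 2))) //.
- rewrite -ge0_integralZl_EFin //; last first.
    exact: measurable_gauss_moment.
  move=> t; rewrite /= in_itv/= andbT => t0.
  by rewrite lee_fin mulr_ge0 ?exprn_ge0 ?expR_ge0.
- by apply: measurableT_comp => //; exact: measurableT_comp.
- move=> s t s0 t0; rewrite -[in LHS](sqr_sqrtr t0) ltr_pXn2r// nnegrE//.
- by move=> s _; exact: sqr_ge0.
- by move=> s _; exact: integral_tail_expRN.
Qed.

Lemma exp_momentE n : exp_moment n = n`!%:R%:E.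
Proof.
elim: n => [|n IH]; last by rewrite exp_momentS IH -EFinM factS natrM.
rewrite fact0 -(@expR0 R) -oppr0 -integral_tail_expRN.
rewrite integral_itv_obnd_cbnd; last first.
  by apply/measurable_EFinP; apply: measurableT_comp => //; exact: measurableT_comp.
by apply: eq_integral => t _; rewrite expr0 mul1r.
Qed.

Lemma gauss_momentE n : gauss_moment n.*2 =
  (Num.sqrt pi * n.*2`!%:R / (2 * 4 ^+ n * n`!%:R))%:E.
Proof.
elim: n => [|n IH].
  rewrite fact0 expr0 !mulr1 -integral0y_gauss.
  by apply: eq_integral => t _; rewrite expr0 mul1r.
have := gauss_momentSS n.*2; rewrite IH -EFinM doubleS => H.
(* The moment on the left is not yet known to be finite, so the factor 2 is cancelled by an explicit
   inverse. *)
have e : 1%E = ((2^-1)%:E * 2%:E)%E :> \bar R by rewrite -EFinM mulVf.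
rewrite -[LHS]mul1e e -muleA H -EFinM.
congr EFin; rewrite !factS !natrM exprS.
have f0 : n`!%:R != 0 :> R by rewrite pnatr_eq0 -lt0n fact_gt0.
have n1 : n.+1%:R != 0 :> R by [].
have p4 : 4 ^+ n != 0 :> R by rewrite expf_neq0.
have -> : n.*2.+2%:R = 2 * n.+1%:R :> R by rewrite -natrM; congr _%:R; lia.
field.
by rewrite f0 nat1r n1 p4.
Qed.

Lemma GammaS n : Gamma (n%:R + 1 : R) = n`!%:R.
Proof.
have := exp_momentE n; rewrite /exp_moment => H.
rewrite /Gamma /Rintegral -[RHS]/(fine _%:E) -H; congr fine.
rewrite -integral_itv_obnd_cbnd; last first.
  apply/measurable_EFinP; apply: measurable_funM; first exact: exprn_measurable.
  exact: measurableT_comp.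
apply: eq_integral => t; rewrite inE/= in_itv/= andbT => t0.
by rewrite addrK powR_mulrn// ltW.
Qed.

(** The integrand t^(n + 1/2) is the power 2n + 1 of sqrt t, so an even Gaussian moment gives the
    value. *)
Lemma Gamma_half n : Gamma (n%:R + 3 / 2 : R) =
  Num.sqrt pi * n.*2.+2`!%:R / (4 ^+ n.+1 * n.+1`!%:R).
Proof.
have := exp_moment_sqrt n.*2; rewrite gauss_momentE -EFinM => H.
transitivity (fine (\int[mu]_(t in Rp) (expR (- t) * Num.sqrt t ^+ n.*2.+1)%:E)).
  rewrite /Gamma /Rintegral; congr fine.
  rewrite -integral_itv_obnd_cbnd; last first.
    apply/measurable_EFinP; apply: measurable_funM.
      exact: measurableT_comp.
    apply: measurable_funX; apply: measurable_funTS.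
    by apply: continuous_measurable_fun => x; exact: sqrt_continuous.
  apply: eq_integral => t; rewrite inE/= in_itv/= andbT => t0.
  rewrite mulrC; congr (_ * _)%:E.
  have -> : n%:R + 3 / 2 - 1 = 2^-1 * n.*2.+1%:R :> R.
    by rewrite -[n.*2.+1%:R]natr1 -muln2 natrM; field.
  by rewrite powRrM powR12_sqrt ?ltW// powR_mulrn// sqrtr_ge0.
rewrite H /= !factS !natrM exprS.
have f0 : n`!%:R != 0 :> R by rewrite pnatr_eq0 -lt0n fact_gt0.
have n1 : n.+1%:R != 0 :> R by [].
have p4 : 4 ^+ n != 0 :> R by rewrite expf_neq0.
have -> : n.*2.+2%:R = 2 * n.+1%:R :> R by rewrite -natrM; congr _%:R; lia.
field.
by rewrite f0 nat1r n1 p4.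
Qed.

End GammaValues.

(** * Polar coordinates *)

Section PolarCoordinates.
Variable R : realType.
Local Notation mu := (@lebesgue_measure R).

(** The pushforward of Lebesgue measure under x -> c x, multiplied by |c|, agrees with Lebesgue
    measure on the intervals ]a, b], hence everywhere. A negative c reverses such an interval into
    [b/c, a/c[, whence the two cases. *)
Lemma ge0_integral_scale (c : R) (f : R -> \bar R) : c != 0 ->
  measurable_fun setT f -> (forall x, 0 <= f x)%E ->
  (\int[mu]_x f x = `|c|%:E * \int[mu]_x f (c * x)%R)%E.
Proof.
move=> c0 mf f0.
pose phi : measurableTypeR R -> measurableTypeR R := *%R c.
have mc : measurable_fun setT phi by exact: mulrl_measurable.
pose k : {nonneg R} := NngNum (normr_ge0 c).
pose nu := mscale k
  (measure_function_pushforward__canonical__measure_function_Measure mu mc).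
have pre (a b : R) : phi @^-1` `]a, b] = if 0 < c then `]a / c, b / c]%classic
    else `[b / c, a / c[%classic.
  apply/seteqP; case: ifPn => [cp|cn]; split => x /=; rewrite !in_itv/=.
  - by rewrite ler_pdivlMr// ltr_pdivrMr// ![x * c]mulrC.
  - by rewrite ler_pdivlMr// ltr_pdivrMr// ![x * c]mulrC.
  - have cn' : c < 0 by rewrite lt_neqAle c0 leNgt.
    by rewrite ler_ndivrMr// ltr_ndivlMr// ![x * c]mulrC andbC.
  - have cn' : c < 0 by rewrite lt_neqAle c0 leNgt.
    by rewrite ler_ndivrMr// ltr_ndivlMr// ![x * c]mulrC andbC.
have nuE : forall X, ocitv X -> lebesgue_measure X = nu X.
  move=> _ [[a b] _ <-] /=.
  rewrite /nu /mscale /= /pushforward pre lebesgue_measure_itv/=.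
  have muoc (x y : R) : mu `]x, y]%classic = if x < y then (y - x)%:E else 0%E.
    have := lebesgue_measure_itv `]x, y]; rewrite /= lte_fin => ->.
    by rewrite EFinB.
  have muco (x y : R) : mu `[x, y[%classic = if x < y then (y - x)%:E else 0%E.
    have := lebesgue_measure_itv `[x, y[; rewrite /= lte_fin => ->.
    by rewrite EFinB.
  rewrite lte_fin; case: (boolP (0 < c)) => cp.
    transitivity (`|c|%:E * (if (a / c < b / c)%R then (b / c - a / c)%:E else 0))%E;
      last by congr (_ * _)%E; apply/esym; exact: muoc.
    rewrite ltr_pM2r ?invr_gt0// gtr0_norm//.
    case: ifP => _; last by rewrite mule0.
    by rewrite -EFinB -EFinM -mulrBl mulrC mulfVK.
  have cn' : c < 0 by rewrite lt_neqAle c0 leNgt.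
  transitivity (`|c|%:E * (if (b / c < a / c)%R then (a / c - b / c)%:E else 0))%E;
    last by congr (_ * _)%E; apply/esym; exact: muco.
  rewrite ltr_nM2r ?invr_lt0// ltr0_norm//.
  case: ifP => _; last by rewrite mule0.
  by rewrite -EFinB -EFinM; congr EFin; field.
rewrite (@eq_measure_integral _ _ _ setT nu mu); last first.
  by move=> A mA _; exact: (lebesgue_measure_unique nuE).
rewrite ge0_integral_mscale//; congr (_ * _)%E.
by rewrite ge0_integral_pushforward// preimage_setT.
Qed.

Lemma integral_itv_cy0 (f : R -> \bar R) : measurable_fun setT f ->
  (forall x, 0 <= f x)%E ->
  (\int[mu]_x f x = \int[mu]_(x in `]0%R, +oo[) (f x + f (- x)%R))%E.
Proof.
move=> mf f0.
have mfN : measurable_fun setT (fun x : R => f (- x)).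
  exact: measurableT_comp.
rewrite ge0_integralD//; last 2 first.
- exact: measurable_funTS.
- exact: measurable_funTS.
have -> : (\int[mu]_(x in `]0%R, +oo[) f (- x)%R = \int[mu]_(x in `]-oo, 0%R]) f x)%E.
  rewrite integral_itv_obnd_cbnd; last exact: measurable_funTS.
  rewrite (@ge0_integration_by_substitution0 _ (fun x : R => f (- x)))//.
  by under eq_integral do rewrite opprK.
rewrite -[LHS]/(\int[mu]_(x in setT) _)%E -(setUv `]-oo, 0%R]%classic) setCitvl.
rewrite ge0_integral_setU; first by rewrite addeC.
- exact: measurable_itv.
- exact: measurable_itv.
- exact: measurable_funTS.
- by move=> x _; exact: f0.
- by rewrite -setCitvl disj_set2E setICr.
Qed.

Lemma continuous_onedsqr : continuous (fun t : R => 1 + t ^+ 2).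
Proof. by move=> t; apply: cvgD; [exact: cvg_cst|exact: exprn_continuous]. Qed.

Lemma cos_atan_gt0 (t : R) : 0 < cos (atan t).
Proof. by rewrite cos_atan invr_gt0 sqrtr_gt0 ltr_wpDr ?sqr_ge0. Qed.

Lemma cos2_atan (t : R) : cos (atan t) ^+ 2 = (1 + t ^+ 2)^-1.
Proof. by rewrite cos_atan exprVn sqr_sqrtr// addr_ge0 ?sqr_ge0. Qed.

Lemma sin_atan (t : R) : sin (atan t) = t * cos (atan t).
Proof.
rewrite -[X in X * _](atanK t) /tan mulfVK// gt_eqF//; exact: cos_atan_gt0.
Qed.

(* With y = x t and then x = r cos (atan t), only linear rescalings of each
   one-dimensional integral are needed. *)
Lemma ge0_integral_polar (F : R * R -> \bar R) : measurable_fun setT F ->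
  (forall z, 0 <= F z)%E ->
  (\int[mu \x mu]_z F z = \int[mu]_t ((1 + t ^+ 2)^-1%:E *
     \int[mu]_(r in `]0%R, +oo[) (r%:E *
      (F (r * cos (atan t), r * sin (atan t))%R +
       F (r * cos (atan t + pi), r * sin (atan t + pi))%R))))%E.
Proof.
move=> mF F0.
have mF2 (g h : R * R -> R) : measurable_fun setT g -> measurable_fun setT h ->
    measurable_fun setT (fun z => F (g z, h z)).
  by move=> mg mh; apply: measurableT_comp => //; exact: measurable_fun_pair.
have mF1 (g h : R -> R) : measurable_fun setT g -> measurable_fun setT h ->
    measurable_fun setT (fun z => F (g z, h z)).
  by move=> mg mh; apply: measurableT_comp => //; exact: measurable_fun_pair.
pose G (z : R * R) := (`|z.1|%:E * F (z.1, z.1 * z.2)%R)%E.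
have mG : measurable_fun setT G.
  apply: emeasurable_funM.
    by apply/measurable_EFinP; apply: measurableT_comp => //.
  by apply: mF2 => //; exact: measurable_funM.
have G0 z : (0 <= G z)%E by rewrite /G mule_ge0 ?lee_fin.
have mGt t : measurable_fun setT (fun x => G (x, t)).
  by apply: measurableT_comp => //; exact: measurable_fun_pair.
rewrite fubini_tonelli1//.
transitivity (\int[mu]_x \int[mu]_t G (x, t))%E.
  (* The substitution y = x t fails only on the line x = 0, a null set. *)
  apply: ae_eq_integral => //.
  - exact: measurable_fun_fubini_tonelli_F.
  - exact: (@measurable_fun_fubini_tonelli_F _ _ _ _ _ mu G).
  - exists [set 0]; split => //; first exact: lebesgue_measure_set1.
    move=> x /= /not_implyP[_]; apply: contra_notP => /eqP x0.
    rewrite /fubini_F (@ge0_integral_scale x)//; last exact: mF1.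
    rewrite -ge0_integralZl_EFin//.
    by apply: mF1 => //; exact: mulrl_measurable.
rewrite (@fubini_tonelli _ _ _ _ R mu mu G)//.
apply: eq_integral => t _.
have c0 := cos_atan_gt0 t.
(* Setting x = r cos (atan t): this Jacobian and the factor |x| of [G] together give cos (atan t)^2
   = 1 / (1 + t^2). *)
rewrite (@ge0_integral_scale (cos (atan t))) ?gt_eqF//.
rewrite -cos2_atan expr2 EFinM -muleA gtr0_norm//; congr (_ * _)%E.
(* Folding x onto x > 0 produces the two opposite rays, at angles atan t and atan t + pi. *)
rewrite integral_itv_cy0; last 2 first.
- apply: (@measurableT_comp _ _ _ _ _ _ (fun y => G (y, t)) _ (fun x => cos (atan t) * x)).
    exact: mGt.
  exact: mulrl_measurable.
- by [].
rewrite -ge0_integralZl_EFin ?ltW//; last 2 first.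
- move=> r; rewrite /= in_itv/= andbT => r0.
  by rewrite mule_ge0 ?adde_ge0// lee_fin ltW.
- apply: measurable_funTS; apply: emeasurable_funM; first exact/measurable_EFinP.
  by apply: emeasurable_funD; apply: mF1; exact: mulrr_measurable.
apply: eq_integral => r; rewrite inE/= in_itv/= andbT => r0.
rewrite /G /= !normrM gtr0_norm// normrN gtr0_norm// -ge0_muleDr//.
rewrite EFinM -!muleA; congr (_ * (_ * _))%E.
rewrite cosDpi sinDpi sin_atan !mulrN mulNr; congr (F (_, _)%R + F (_, _)%R)%E; ring.
Qed.

End PolarCoordinates.

(** * The radial profile of the weight *)

Section RadialProfile.
Variable R : realType.
Local Notation mu := (@lebesgue_measure R).

(* [incbeta a b] is the primitive of X^a (2 - X)^b vanishing at 0. *)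
Definition incbeta_cofactor (a b : nat) : {poly R} :=
  \poly_(i < b.+1) (((2%:P - 'X) ^+ b)`_i / (a + i).+1%:R).

Definition incbeta (a b : nat) : {poly R} := 'X^(a.+1) * incbeta_cofactor a b.

Lemma size_two_subX_exp b : (size ((2%:P - 'X : {poly R}) ^+ b) <= b.+1)%N.
Proof.
elim: b => [|b IH]; first by rewrite expr0 size_poly1.
rewrite exprS (leq_trans (size_polyMleq _ _))//.
have : (size (2%:P - 'X : {poly R})%R <= 2)%N.
  by rewrite -size_polyN opprB size_XsubC.
lia.
Qed.

Lemma horner_two_subX_exp b (z : R) : ((2%:P - 'X) ^+ b).[z] = (2 - z) ^+ b.
Proof. by rewrite horner_exp hornerD hornerN hornerX hornerC. Qed.

(** This is (X^(a+1) T)' = X^a (2 - X)^b with the factor X^a divided out, so that it still carries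
    information at 0. *)
Lemma incbeta_cofactor_ode (a b : nat) :
  'X * (incbeta_cofactor a b)^`() + a.+1%:R *: incbeta_cofactor a b =
  (2%:P - 'X) ^+ b.
Proof.
have coefT i : (incbeta_cofactor a b)`_i = ((2%:P - 'X) ^+ b)`_i / (a + i).+1%:R.
  rewrite coef_poly; case: ltnP => // bi.
  by rewrite nth_default ?mul0r// (leq_trans (size_two_subX_exp b)).
apply/polyP => i; rewrite coefD coefXM coefZ coef_deriv.
case: i => [|i] /=; first by rewrite add0r coefT addn0 mulrC divfK.
rewrite !coefT -[X in X + _]mulr_natl -mulrDl -natrD mulrCA.
by rewrite (_ : (i.+1 + a.+1)%N = (a + i.+1).+1) ?mulfV ?mulr1//; lia.
Qed.

Lemma deriv_incbeta a b : (incbeta a b)^`() = 'X^a * (2%:P - 'X) ^+ b.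
Proof.
rewrite /incbeta derivM derivXn -(incbeta_cofactor_ode a b) /= mulrDr exprSr.
by rewrite -scaler_nat -!scalerAl -scalerAr mulrA addrC.
Qed.

Lemma incbeta0 a b : (incbeta a b).[0] = 0.
Proof. by rewrite /incbeta hornerM hornerXn expr0n mul0r. Qed.

(* The integral of x^a (2 - x)^b over [0, 2], split at 1. *)
Definition beta_sum a b : R := (incbeta a b).[1] + (incbeta b a).[1].

Lemma poly_deriv_inj (p q : {poly R}) : p^`() = q^`() -> p.[0] = q.[0] -> p = q.
Proof.
move=> pq p0; apply/polyP => -[|i]; first by rewrite -!horner_coef0.
have := congr1 (fun r : {poly R} => r`_i) pq; rewrite !coef_deriv.
rewrite -[LHS]mulr_natr -[RHS]mulr_natr; apply: mulIf.
by rewrite pnatr_eq0.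
Qed.

(** The boundary term is 1 because x and 2 - x are both 1 at x = 1. In [beta_sum] the boundary terms
    of the two halves cancel. *)
Lemma incbeta_by_parts a b :
  a.+1%:R * (incbeta a b.+1).[1] = 1 + b.+1%:R * (incbeta a.+1 b).[1].
Proof.
suff : a.+1%:R *: incbeta a b.+1 =
    'X^(a.+1) * (2%:P - 'X) ^+ b.+1 + b.+1%:R *: incbeta a.+1 b :> {poly R}.
  move=> /(congr1 (horner^~ 1)); rewrite hornerZ => ->.
  by rewrite !hornerE/= !expr1n mul1r (_ : 2 - 1 = 1 :> R) ?expr1n//; ring.
apply: poly_deriv_inj; last first.
  by rewrite hornerD !hornerZ !incbeta0 hornerM hornerXn exprS !mul0r !mulr0 addr0.
rewrite derivZ derivD derivZ !deriv_incbeta derivM derivXn deriv_exp /=.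
by rewrite derivB derivC derivX sub0r !scaler_nat; ring.
Qed.

(** With x = 2u this is 2^(a+b+1) times Euler's beta function at (a+1, b+1). The induction moves one
    unit from b to a by integration by parts. *)
Lemma beta_sumE a b : beta_sum a b =
  2 ^+ (a + b).+1 * (a`! * b`!)%:R / (a + b).+1`!%:R.
Proof.
elim: b a => [|b IH] a.
  have -> : beta_sum a 0 = 2 ^+ a.+1 / a.+1%:R.
    have i0 c : (incbeta c 0).[1] = c.+1%:R^-1.
      rewrite /incbeta hornerM hornerXn expr1n mul1r /incbeta_cofactor.
      by rewrite poly_def big_ord1 expr0 alg_polyC hornerC addn0 coefC/= div1r.
    suff : a.+1%:R *: incbeta 0 a = (2 ^+ a.+1)%:P - (2%:P - 'X) ^+ a.+1 :> {poly R}.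
      move=> /(congr1 (horner^~ 1)); rewrite hornerZ hornerD hornerN hornerC.
      rewrite horner_two_subX_exp (_ : 2 - 1 = 1 :> R) ?expr1n; last by ring.
      move=> H; have a0 : a.+1%:R != 0 :> R by [].
      by apply: (mulfI a0); rewrite /beta_sum mulrDr H i0 mulfV// mulrCA mulfV// mulr1; ring.
    apply: poly_deriv_inj; last first.
      rewrite hornerZ incbeta0 hornerD hornerN hornerC horner_two_subX_exp subr0.
      by rewrite mulr0 subrr.
    rewrite derivZ deriv_incbeta derivB derivC deriv_exp derivB derivC derivX.
    by rewrite expr0 sub0r !scaler_nat /=; ring.
  rewrite addn0 fact0 muln1 factS natrM.
  have f0 : a`!%:R != 0 :> R by rewrite pnatr_eq0 -lt0n fact_gt0.
  by field; rewrite f0 nat1r pnatr_eq0.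
have H : a.+1%:R * beta_sum a b.+1 = b.+1%:R * beta_sum a.+1 b.
  rewrite /beta_sum !mulrDr.
  have := incbeta_by_parts a b; have := incbeta_by_parts b a; lra.
have a0 : a.+1%:R != 0 :> R by [].
apply: (mulfI a0); rewrite H IH addSnnS !factS !natrM; ring.
Qed.

Variable m : nat.

(** For z = 2s / (1 + s) this is 2 - z, while z itself is s times it; hence z^a (2 - z)^b is a power
    of s times a power of [radial_q s]. *)
Definition radial_q (s : R) : R := 2 / (1 + s).

(* For r <= 1, r^(2m+2) V(r^2) is the tail integral in the definition of tau;
   dividing out the power leaves a function smooth at r = 0. *)
Definition radial_V (s : R) : R :=
  radial_q s ^+ m.+1 * (incbeta_cofactor m m).[s * radial_q s].

Lemma radial_VE (s : R) : s ^+ m.+1 * radial_V s = (incbeta m m).[s * radial_q s].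
Proof. by rewrite /radial_V /incbeta hornerM hornerXn [in RHS]exprMn mulrA. Qed.

Lemma radial_q_gt0 (s : R) : 0 <= s -> 0 < radial_q s.
Proof. by move=> s0; rewrite divr_gt0// ltr_pwDl. Qed.

Lemma is_derive_radial_q (s : R) : 0 <= s ->
  is_derive s (1 : R) radial_q (- radial_q s ^+ 2 / 2).
Proof.
move=> s0.
have s1 : 1 + s != 0 by rewrite gt_eqF// ltr_pwDl.
by rewrite /radial_q; apply: is_derive_eq; rewrite /GRing.scale/=; field.
Qed.

Lemma is_derive_radial_z (s : R) : 0 <= s ->
  is_derive s (1 : R) (fun s => s * radial_q s) (radial_q s ^+ 2 / 2).
Proof.
move=> s0; have := is_derive_radial_q s0 => dq.
have s1 : 1 + s != 0 by rewrite gt_eqF// ltr_pwDl.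
apply: is_derive_eq; rewrite /GRing.scale/= /radial_q; field.
exact: s1.
Qed.

Definition radial_dV (s : R) : R :=
  radial_q s ^+ m.+1 * (radial_q s ^+ 2 / 2) *
    (incbeta_cofactor m m)^`().[s * radial_q s] -
  m.+1%:R * radial_q s ^+ m.+2 / 2 * (incbeta_cofactor m m).[s * radial_q s].

Lemma is_derive_radial_V (s : R) : 0 <= s ->
  is_derive s (1 : R) radial_V (radial_dV s).
Proof.
move=> s0; have dq := is_derive_radial_q s0; have dz := is_derive_radial_z s0.
have dT := is_derive_poly (incbeta_cofactor m m) (s * radial_q s).
have dTz := @is_derive1_comp R (horner (incbeta_cofactor m m))
  (fun s => s * radial_q s) s _ _ dT dz.
have dX : is_derive s (1 : R) (fun s => radial_q s ^+ m.+1)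
    (- m.+1%:R * radial_q s ^+ m.+2 / 2).
  have := @is_derive1_comp R (fun x => x ^+ m.+1) radial_q s _ _
    (is_derive_monomial m (radial_q s)) dq => dX.
  by apply: (is_derive_eq dX); rewrite !exprS; field.
have := @is_deriveM R R _ _ s (1 : R) _ _ dX dTz => dV.
apply: (is_derive_eq dV).
rewrite /GRing.scale/= /radial_dV; ring.
Qed.

(** Differentiate s^(m+1) V(s) = K(z) with K'(z) = z^m q^m and dz/ds = q^2 / 2, then divide by s^m.
    The proof starts from the equation of the cofactor, where this division is already done, so s =
    0 is included. *)
Lemma radial_V_ode (s : R) : 0 <= s ->
  s * radial_dV s = radial_q s ^+ m.*2.+2 / 2 - m.+1%:R * radial_V s.
Proof.
move=> s0; have q0 := radial_q_gt0 s0.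
have /(congr1 (horner^~ (s * radial_q s))) := incbeta_cofactor_ode m m.
rewrite hornerD hornerM hornerX hornerZ horner_two_subX_exp => H.
have zq : 2 - s * radial_q s = radial_q s.
  by rewrite /radial_q; field; rewrite gt_eqF// ltr_pwDl.
rewrite zq in H.
have -> : radial_q s ^+ m.*2.+2 = radial_q s ^+ m * (radial_q s ^+ m * radial_q s ^+ 2).
  by rewrite -!exprD; congr (_ ^+ _); lia.
rewrite -{2}H /radial_dV /radial_V !exprS.
set T := _.[_]; set T' := _.[_]; move: (radial_q s) (_ ^+ m) zq => q Q zq.
have e : s * q = 2 - q by lra.
set k := m.+1%:R.
transitivity (s * q * (Q * (q ^+ 2 / 2) * T - k * q * Q / 2 * T')); first by ring.
by rewrite e; field.
Qed.

(** By the equation for V, the derivative of s^(a+1) V is (a - m) s^a V + s^a q^(2m+2) / 2. When a +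
    b = 2m the second term is the derivative of [incbeta a b] at z, which is subtracted, and the
    coefficients a - m and b - m are opposite. *)
Definition radial_primitive a b (s : R) : R :=
  (s ^+ a.+1 + s ^+ b.+1) * radial_V s -
  ((incbeta a b).[s * radial_q s] + (incbeta b a).[s * radial_q s]).

Lemma is_derive_radial_primitive a b (s : R) : (a + b = m.*2)%N -> 0 <= s ->
  is_derive s (1 : R) (radial_primitive a b)
    ((a%:R - m%:R) * ((s ^+ a - s ^+ b) * radial_V s)).
Proof.
move=> abm s0; have dz := is_derive_radial_z s0; have dV := is_derive_radial_V s0.
have dI c d := @is_derive1_comp R (horner (incbeta c d))
  (fun s => s * radial_q s) s _ _ (is_derive_poly (incbeta c d) (s * radial_q s)) dz.
have dX n := @is_derive_monomial R n s.
have dXX := @is_deriveD R R R _ _ s (1 : R) _ _ (dX a) (dX b).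
have dXV := @is_deriveM R R _ _ s (1 : R) _ _ dXX dV.
have dII := @is_deriveD R R R _ _ s (1 : R) _ _ (dI a b) (dI b a).
have := @is_deriveB R R R _ _ s (1 : R) _ _ dXV dII => dF.
apply: (is_derive_eq dF).
have zq : 2 - s * radial_q s = radial_q s.
  by rewrite /radial_q; field; rewrite gt_eqF// ltr_pwDl.
have ode := radial_V_ode s0.
transitivity ((s ^+ a.+1 + s ^+ b.+1) * radial_dV s +
    radial_V s * (a.+1%:R * s ^+ a + b.+1%:R * s ^+ b) -
   ((incbeta a b)^`().[s * radial_q s] * (radial_q s ^+ 2 / 2) +
    (incbeta b a)^`().[s * radial_q s] * (radial_q s ^+ 2 / 2))); first by [].
rewrite !deriv_incbeta !hornerM !hornerXn !horner_two_subX_exp zq.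
have powz n : (s * radial_q s) ^+ n = s ^+ n * radial_q s ^+ n by exact: exprMn.
rewrite !powz.
have -> : (s ^+ a * radial_q s ^+ a * radial_q s ^+ b) = s ^+ a * radial_q s ^+ m.*2.
  by rewrite -mulrA -exprD abm.
have -> : (s ^+ b * radial_q s ^+ b * radial_q s ^+ a) = s ^+ b * radial_q s ^+ m.*2.
  by rewrite -mulrA -exprD addnC abm.
have mab : m%:R = (a%:R + b%:R) / 2 :> R.
  by rewrite -natrD abm -muln2 natrM mulfK.
rewrite !exprS in ode *; rewrite /= -[a.+1%:R]natr1 -[b.+1%:R]natr1 -[m.+1%:R]natr1 mab in ode *.
move: ode; move: (radial_q s ^+ m.*2) (radial_q s) (radial_V s) (radial_dV s) (s ^+ a) (s ^+ b).
move=> Q q V dV' sa sb ode.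
have -> : (s * sa + s * sb) * dV' = (sa + sb) * (s * dV') by ring.
rewrite ode.
by field.
Qed.

Lemma continuous_radial_V (s : R) : 0 <= s -> {for s, continuous radial_V}.
Proof.
move=> s0; apply: differentiable_continuous; apply/derivable1_diffP.
by have [] := is_derive_radial_V s0.
Qed.

(** At s = 1 the point z is 1, the midpoint of [0, 2], and x^m (2 - x)^m is symmetric about it. *)
Lemma radial_V1 : radial_V 1 = beta_sum m m / 2.
Proof.
have q1 : radial_q 1 = 1 by rewrite /radial_q; field.
rewrite /beta_sum -[LHS]mul1r -[X in X * _](expr1n _ m.+1) radial_VE q1 mulr1.
by field.
Qed.

Definition radial_moment (e : nat) : R :=
  \int[mu]_(r in `[0, 1]) (r * (radial_V (r ^+ 2) * r ^+ e)).

Lemma continuous_radial_moment (e : nat) (r : R) :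
  {for r, continuous (fun r : R => r * (radial_V (r ^+ 2) * r ^+ e))}.
Proof.
apply: continuousM => //; apply: continuousM; last exact: exprn_continuous.
apply: continuous_comp; first exact: exprn_continuous.
by apply: continuous_radial_V; exact: sqr_ge0.
Qed.

Lemma integrable_radial_moment (e : nat) :
  mu.-integrable `[0, 1] (EFin \o (fun r : R => r * (radial_V (r ^+ 2) * r ^+ e))).
Proof.
apply: continuous_compact_integrable; first exact: segment_compact.
by apply: continuous_subspaceT => r; exact: continuous_radial_moment.
Qed.

Lemma radial_momentB a b : (a + b = m.*2)%N -> a != m ->
  radial_moment a.*2 - radial_moment b.*2 =
  (beta_sum m m - beta_sum a b) / (2 * (a%:R - m%:R)).
Proof.
move=> abm am.
have am0 : a%:R - m%:R != 0 :> R by rewrite subr_eq0 eqr_nat.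
rewrite /radial_moment -RintegralB//; last 2 first.
- exact: integrable_radial_moment.
- exact: integrable_radial_moment.
(* With s = r^2, r dr is ds / 2; this explains the factor 2. *)
pose F (r : R) := (2 * (a%:R - m%:R))^-1 * radial_primitive a b (r ^+ 2).
have dF (r : R) : is_derive r (1 : R) F
    (r * (radial_V (r ^+ 2) * r ^+ a.*2) - r * (radial_V (r ^+ 2) * r ^+ b.*2)).
  have dr := @is_derive_monomial R 1 r.
  have := @is_derive1_comp R (radial_primitive a b) (fun r => r ^+ 2) r _ _
    (is_derive_radial_primitive abm (sqr_ge0 r)) dr => dP.
  have := is_deriveZ (2 * (a%:R - m%:R))^-1 dP => dF.
  apply: (is_derive_eq dF); rewrite /GRing.scale/= -!exprM !mul2n; field.
  by [].
rewrite (@Rintegral_FTC2 _ F)//; last first.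
  by move=> r _; apply: cvgB; exact: continuous_radial_moment.
have e0 n : (0 : R) ^+ n.+1 = 0 by rewrite exprS mul0r.
rewrite /F /radial_primitive !expr1n radial_V1 /beta_sum !e0 !mul0r !incbeta0.
have -> : radial_q 1 = 1 by rewrite /radial_q; field.
rewrite mul1r addr0 mul0r subr0 mulr0 subr0; field.
by [].
Qed.

End RadialProfile.

(** * The radicand of tau as an explicit function of the radius *)

Section WeightProfile.
Variable R : realType.
Variable m : nat.
Local Notation mu := (@lebesgue_measure R).

Lemma one_sub_sin2_atan (t : R) : (1 - sin (atan t)) * (1 + sin (atan t)) = cos (atan t) ^+ 2.
Proof. by rewrite -subr_sqr expr1n -(cos2Dsin2 (atan t)) addrK. Qed.

Lemma powR_tailE (t : R) :
  ((1 + t ^+ 2) `^ ((m.*2.+1)%:R / 2 + 1))^-1 = cos (atan t) ^+ m.*2.+3.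
Proof.
have t0 : 0 <= 1 + t ^+ 2 by rewrite addr_ge0 ?sqr_ge0.
have -> : (m.*2.+1)%:R / 2 + 1 = 2^-1 * m.*2.+3%:R :> R.
  by rewrite -[m.*2.+3%:R]natr1 -[m.*2.+2%:R]natr1; field.
by rewrite powRrM powR12_sqrt// powR_mulrn ?sqrtr_ge0// cos_atan exprVn.
Qed.

(** With u = 1 - sin (atan t), du = - cos (atan t)^3 dt and u (2 - u) = cos (atan t)^2, so u^m (2 -
    u)^m accounts for the remaining 2m cosines; u tends to 0 as t tends to infinity. *)
Lemma tail_integralE (x : R) :
  \int[mu]_(t in `[x, +oo[) ((1 + t ^+ 2) `^ ((m.*2.+1)%:R / 2 + 1))^-1 =
  (incbeta R m m).[1 - sin (atan x)].
Proof.
transitivity (\int[mu]_(t in `[x, +oo[) cos (atan t) ^+ m.*2.+3).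
  by apply: eq_Rintegral => t _; exact: powR_tailE.
pose F (t : R) := - (incbeta R m m).[1 - sin (atan t)].
have cca : continuous (fun t : R => cos (atan t)).
  by move=> t; apply: continuous_comp; [exact: continuous_atan|exact: continuous_cos].
have dF (t : R) : is_derive t (1 : R) F (cos (atan t) ^+ m.*2.+3).
  have da : is_derive t (1 : R) (@atan R) (cos (atan t) ^+ 2).
    apply: DeriveDef; first exact: derivable_atan.
    by rewrite -derive1E derive1_atan cos2_atan.
  have ds := @is_derive1_comp R (@sin R) (@atan R) t _ _ (is_derive_sin _) da.
  have d1 := @is_deriveB R R R (cst 1) _ t (1 : R) _ _ (is_derive_cst _ _ _) ds.
  have dI := @is_derive1_comp R (horner (incbeta R m m)) _ t _ _
    (is_derive_poly (incbeta R m m) (1 - sin (atan t))) d1.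
  have dN := is_deriveN dI.
  apply: (is_derive_eq dN).
  rewrite deriv_incbeta hornerM hornerXn horner_two_subX_exp.
  rewrite (_ : 2 - (1 - _) = 1 + sin (atan t)); last by ring.
  rewrite -exprMn one_sub_sin2_atan sub0r mulrN opprK -exprM.
  by rewrite mul2n -exprS -exprD addn3.
rewrite /Rintegral (@ge0_integral_FTC2y _ F _ x 0 (fun t _ => dF t)).
- by rewrite /= /F sub0r opprK.
- move=> t _; exact: (@continuous_comp _ _ _ (fun t => cos (atan t))
    (fun x : R => x ^+ m.*2.+3) t (cca t) (@exprn_continuous _ _ _)).
- by move=> t _; rewrite exprn_ge0// ltW// cos_atan_gt0.
- have -> : 0 = - (incbeta R m m).[1 - sin (pi / 2)] by rewrite sin_pihalf subrr incbeta0 oppr0.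
  apply: cvgN; apply: (@cvg_comp _ _ _ _ (horner (incbeta R m m))); last exact: continuous_horner.
  apply: cvgB; first exact: cvg_cst.
  by apply: (@cvg_comp _ _ _ _ (@sin R)); [exact: cvgy_atan|exact: continuous_sin].
Qed.

(** The number 1 + ((1/r - r)/2)^2 is the square of (1/r + r)/2, so the square root in the sine
    disappears and a rational function of r^2 remains. *)
Lemma sin_atan_joukowski (r : R) : 0 < r ->
  1 - sin (atan ((r^-1 - r) / 2)) = r ^+ 2 * radial_q (r ^+ 2).
Proof.
move=> r0; rewrite sin_atan cos_atan.
have -> : 1 + ((r^-1 - r) / 2) ^+ 2 = ((r^-1 + r) / 2) ^+ 2.
  by field; rewrite gt_eqF.
have p0 : 0 < r^-1 + r by rewrite addr_gt0 ?invr_gt0.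
rewrite sqrtr_sqr gtr0_norm ?divr_gt0// /radial_q.
by field; rewrite !gt_eqF ?addr_gt0 ?exprn_gt0//.
Qed.

(** The radicand of tau at modulus r. In the disc integral tau is taken at radii r and 1/r, and the
    symmetry [weight2V] turns the product of the two roots into this function. *)
Definition weight2 (r : R) : R := (Num.sqrt pi)^-1 *
  (incbeta R m m).[1 - sin (atan (`|r^-1 - r| / 2))].

Lemma weight2V (r : R) : weight2 r^-1 = weight2 r.
Proof. by rewrite /weight2 invrK distrC. Qed.

Lemma weight2E (r : R) : 0 < r -> r <= 1 ->
  weight2 r = (Num.sqrt pi)^-1 * (r ^+ m.*2.+2 * radial_V m (r ^+ 2)).
Proof.
move=> r0 r1; rewrite /weight2 ger0_norm; last first.
  by rewrite subr_ge0 (le_trans r1)// invf_ge1.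
by rewrite sin_atan_joukowski// -radial_VE -exprM mul2n.
Qed.

Lemma weight2_1 : weight2 1 = (Num.sqrt pi)^-1 * (beta_sum R m m / 2).
Proof. by rewrite weight2E// !expr1n mul1r radial_V1. Qed.

Lemma tau_weight2E (x : R[i]) : tau m.*2.+1 x =
  x ^- m * (Num.sqrt (weight2 (Normc.normc x)))%:C.
Proof. by rewrite /tau tail_integralE /= doubleK. Qed.

Lemma incbeta_ge0 (z : R) : 0 <= z <= 2 -> 0 <= (incbeta R m m).[z].
Proof.
move=> /andP[z0 z2].
have <- : \int[mu]_(x in `[0, z]) (incbeta R m m)^`().[x] = (incbeta R m m).[z].
  rewrite (@Rintegral_FTC2 _ (horner (incbeta R m m)))//.
  - by rewrite incbeta0 subr0.
  - by move=> x _; exact: is_derive_poly.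
  - by move=> x _; exact: continuous_horner.
apply: Rintegral_ge0 => x; rewrite /= in_itv/= => /andP[x0 xz].
rewrite deriv_incbeta hornerM hornerXn horner_two_subX_exp.
by rewrite mulr_ge0 ?exprn_ge0// subr_ge0 (le_trans xz).
Qed.

Lemma weight2_ge0 (r : R) : 0 <= weight2 r.
Proof.
rewrite /weight2 mulr_ge0 ?invr_ge0 ?sqrtr_ge0// incbeta_ge0//.
have := sin_geN1 (atan (`|r^-1 - r| / 2)); have := sin_le1 (atan (`|r^-1 - r| / 2)).
by move=> *; lra.
Qed.

Lemma radial_V_ge0 (r : R) : 0 < r -> r <= 1 -> 0 <= radial_V m (r ^+ 2).
Proof.
move=> r0 r1; have := weight2_ge0 r; rewrite weight2E//.
by rewrite pmulr_rge0 ?invr_gt0 ?sqrtr_gt0 ?pi_gt0// pmulr_rge0 ?exprn_gt0.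
Qed.

(** A case of Legendre's duplication formula, reduced to factorials by the integer and half-integer
    values of Gamma. *)
Lemma Gamma_ratio : Gamma (((m.*2.+1)%:R + 1) / 2 : R) / Gamma ((m.*2.+1)%:R / 2 + 1 : R) =
  beta_sum R m m / Num.sqrt pi.
Proof.
have -> : (m.*2.+1%:R + 1) / 2 = m%:R + 1 :> R.
  by rewrite -[m.*2.+1%:R]natr1 -muln2 natrM; field.
have -> : m.*2.+1%:R / 2 + 1 = m%:R + 3 / 2 :> R.
  by rewrite -[m.*2.+1%:R]natr1 -muln2 natrM; field.
rewrite GammaS Gamma_half beta_sumE addnn.
have sp : Num.sqrt pi != 0 :> R by rewrite gt_eqF// sqrtr_gt0 pi_gt0.
have f0 n : n`!%:R != 0 :> R by rewrite pnatr_eq0 -lt0n fact_gt0.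
have -> : m.*2.+2`!%:R = 2 * m.+1%:R * m.*2.+1`!%:R :> R.
  by rewrite factS -!natrM; congr (_ * _)%:R; lia.
have -> : m.+1`!%:R = m.+1%:R * m`!%:R :> R by rewrite factS natrM.
have -> : 4 ^+ m.+1 = 2 * 2 ^+ m.*2.+1 :> R.
  by rewrite -exprS (_ : m.*2.+2 = (2 * m.+1)%N) ?exprM; [congr (_ ^+ _); ring|lia].
have p2 : 2 ^+ m.*2.+1 != 0 :> R by rewrite expf_neq0.
rewrite natrM; have := f0 m.*2.+1; move: (m.*2.+1`!%:R) (2 ^+ m.*2.+1) p2 => F P P0 F0.
by field; rewrite sp f0 F0 P0 nat1r pnatr_eq0.
Qed.

End WeightProfile.

(** * Complex-valued integrals *)

Section ComplexIntegrals.
Variable R : realType.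

Section GeneralMeasure.
Variables (d : measure_display) (T : measurableType d) (mu : {measure set T -> \bar R}).
Variables (D : set T) (mD : measurable D).

Definition Cintegrable (f : T -> R[i]) : Prop :=
  mu.-integrable D (EFin \o (fun x => complex.Re (f x))) /\
  mu.-integrable D (EFin \o (fun x => complex.Im (f x))).

Lemma eq_Cintegral (f g : T -> R[i]) : (forall x, D x -> f x = g x) ->
  Cintegral mu D f = Cintegral mu D g.
Proof.
by move=> fg; congr (_ +i* _); apply: eq_Rintegral => x /set_mem Dx; rewrite fg.
Qed.

Lemma eq_Cintegrable (f g : T -> R[i]) : (forall x, D x -> f x = g x) ->
  Cintegrable f -> Cintegrable g.
Proof.
move=> fg [rf imf]; split; [apply: eq_integrable rf|apply: eq_integrable imf] => // x /set_mem Dx /=; by rewrite fg.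
Qed.

Lemma CintegrableD (f g : T -> R[i]) : Cintegrable f -> Cintegrable g ->
  Cintegrable (fun x => f x + g x).
Proof.
move=> [rf imf] [rg ig]; split.
  apply: eq_integrable (integrableD mD rf rg) => // x _ /=.
  by case: (f x) => a b; case: (g x).
apply: eq_integrable (integrableD mD imf ig) => // x _ /=.
by case: (f x) => a b; case: (g x).
Qed.

Lemma CintegralD (f g : T -> R[i]) : Cintegrable f -> Cintegrable g ->
  Cintegral mu D (fun x => f x + g x) = Cintegral mu D f + Cintegral mu D g.
Proof.
move=> [rf imf] [rg ig]; rewrite /Cintegral; simpc; congr (_ +i* _).
  rewrite -RintegralD//; apply: eq_Rintegral => x _.
  by case: (f x) => a b; case: (g x).
rewrite -RintegralD//; apply: eq_Rintegral => x _.
by case: (f x) => a b; case: (g x).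
Qed.

Lemma CintegrableZ (c : R[i]) (f : T -> R[i]) : Cintegrable f ->
  Cintegrable (fun x => c * f x).
Proof.
case: c => a b [rf imf]; split.
  apply: eq_integrable (integrableB mD (integrableZl mD a rf) (integrableZl mD b imf)) => // x _ /=.
  by case: (f x) => u v.
apply: eq_integrable (integrableD mD (integrableZl mD a imf) (integrableZl mD b rf)) => // x _ /=.
by case: (f x) => u v.
Qed.

Lemma CintegralZ (c : R[i]) (f : T -> R[i]) : Cintegrable f ->
  Cintegral mu D (fun x => c * f x) = c * Cintegral mu D f.
Proof.
case: c => a b [rf imf]; rewrite /Cintegral; simpc.
have iz (k : R) (h : T -> R) : mu.-integrable D (EFin \o h) ->
    mu.-integrable D (EFin \o (fun x => k * h x)).
  by move=> ih; apply: eq_integrable (integrableZl mD k ih).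
congr (_ +i* _).
  rewrite -!RintegralZl// -RintegralB//; [|exact: iz|exact: iz].
  by apply: eq_Rintegral => x _; case: (f x).
rewrite -!RintegralZl// -RintegralD//; [|exact: iz|exact: iz].
by apply: eq_Rintegral => x _; case: (f x).
Qed.

Lemma Cintegrable0 : Cintegrable (fun=> 0).
Proof. by split; exact: integrable0. Qed.

Lemma Cintegral0 : Cintegral mu D (fun=> 0) = 0.
Proof.
by rewrite /Cintegral; congr (_ +i* _); rewrite /Rintegral /= integral0.
Qed.

Lemma Cintegrable_sum (n : nat) (F : 'I_n -> T -> R[i]) :
  (forall i, Cintegrable (F i)) -> Cintegrable (fun x => \sum_(i < n) F i x).
Proof.
move=> iF; elim: n F iF => [|n IH] F iF.
  by apply: eq_Cintegrable Cintegrable0 => x _; rewrite big_ord0.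
apply: (@eq_Cintegrable (fun x => \sum_(i < n) F (widen_ord (leqnSn n) i) x + F ord_max x)).
  by move=> x _; rewrite big_ord_recr.
by apply: CintegrableD => //; apply: IH => i.
Qed.

Lemma Cintegral_sum (n : nat) (F : 'I_n -> T -> R[i]) :
  (forall i, Cintegrable (F i)) ->
  Cintegral mu D (fun x => \sum_(i < n) F i x) = \sum_(i < n) Cintegral mu D (F i).
Proof.
move=> iF; elim: n F iF => [|n IH] F iF.
  rewrite [RHS]big_ord0; transitivity (Cintegral mu D (fun=> 0)).
    by apply: eq_Cintegral => x _; rewrite big_ord0.
  exact: Cintegral0.
rewrite big_ord_recr/= -IH// -CintegralD//; last exact: Cintegrable_sum.
by apply: eq_Cintegral => x _; rewrite big_ord_recr.
Qed.

End GeneralMeasure.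

Local Notation mu := (@lebesgue_measure R).

Definition Ccontinuous (f : R -> R[i]) : Prop :=
  continuous (fun x => complex.Re (f x)) /\ continuous (fun x => complex.Im (f x)).

Definition Cis_primitive (F f : R -> R[i]) : Prop := forall x : R,
  is_derive x (1 : R) (fun x => complex.Re (F x)) (complex.Re (f x)) /\
  is_derive x (1 : R) (fun x => complex.Im (F x)) (complex.Im (f x)).

Lemma Ccontinuous_integrable (f : R -> R[i]) (a b : R) : Ccontinuous f ->
  Cintegrable mu `[a, b] f.
Proof.
by move=> [cr ci]; split; apply: continuous_compact_integrable;
  [exact: segment_compact|exact: continuous_subspaceT|exact: segment_compact|
   exact: continuous_subspaceT].
Qed.

Lemma CintegralFTC2 (F f : R -> R[i]) (a b : R) : a <= b ->
  Ccontinuous f -> Cis_primitive F f ->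
  Cintegral mu `[a, b] f = F b - F a.
Proof.
move=> ab [cr ci] dF; rewrite /Cintegral.
rewrite (@Rintegral_FTC2 _ (fun x => complex.Re (F x)))//; last first.
- by move=> x _; have [] := dF x.
rewrite (@Rintegral_FTC2 _ (fun x => complex.Im (F x)))//; last first.
- by move=> x _; have [] := dF x.
by case: (F b) => ? ?; case: (F a).
Qed.

Lemma integrable_sg (f : R -> R) (T t : R) : continuous f ->
  mu.-integrable `[0, T] (EFin \o (fun x => f x * Num.sg (x - t))).
Proof.
move=> cf.
have fi : mu.-integrable `[0, T] (EFin \o f).
  apply: continuous_compact_integrable; first exact: segment_compact.
  exact: continuous_subspaceT.
apply: le_integrable fi => //.
  apply/measurable_EFinP; apply: measurable_funM.
    by apply: measurable_funTS; exact: continuous_measurable_fun.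
  apply: measurable_funTS; apply: nondecreasing_measurable => // x y xy.
  rewrite /Num.sg; move: xy.
  by case: (ltrgtP (x - t) 0); case: (ltrgtP (y - t) 0); lra.
move=> x _; rewrite /= lee_fin normrM normr_sg.
by rewrite ler_piMr//; case: (_ != _).
Qed.

(** The sign cuts the interval at t: the left part gives - (F t - F 0), the right part F T - F t. *)
Lemma Rintegral_sg (F f : R -> R) (T t : R) : continuous f ->
  (forall x : R, is_derive x (1 : R) F (f x)) -> 0 <= t <= T ->
  \int[mu]_(x in `[0, T]) (f x * Num.sg (x - t)) = F T + F 0 - 2 * F t.
Proof.
move=> cf dF /andP[t0 tT].
have isg := @integrable_sg f T t cf.
have fi a b : mu.-integrable `[a, b] (EFin \o f).
  apply: continuous_compact_integrable; first exact: segment_compact.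
  exact: continuous_subspaceT.
have FTC a b : a <= b -> \int[mu]_(x in `[a, b]) f x = F b - F a.
  by move=> ab; apply: Rintegral_FTC2 => // x _; exact: cf.
have -> : `[0, T]%classic = `[0, t[%classic `|` `[t, T]%classic :> set R.
  rewrite -itv_bndbnd_setU ?bnd_simp//.
rewrite Rintegral_setU//=; last 2 first.
- rewrite -itv_bndbnd_setU ?bnd_simp//.
- apply/disj_setPS => x [] /=; rewrite !in_itv/= => /andP[_ xt] /andP[tx _].
  by have := le_lt_trans tx xt; rewrite ltxx.
have -> : \int[mu]_(x in `[0, t[) (f x * Num.sg (x - t)) = - (F t - F 0).
  rewrite -FTC// -Rintegral_itv_bndo_bndc; last first.
    by apply: integrableS (fi 0 t) => // y /=; rewrite !in_itv/= => /andP[-> /ltW].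
  transitivity (\int[mu]_(x in `[0, t[) (-1 * f x)); last first.
    rewrite RintegralZl ?mulN1r//.
    by apply: integrableS (fi 0 t) => // y /=; rewrite !in_itv/= => /andP[-> /ltW].
  apply: eq_Rintegral => x; rewrite inE/= in_itv/= => /andP[_ xt].
  by rewrite ltr0_sg ?subr_lt0// mulrC.
have -> : \int[mu]_(x in `[t, T]) (f x * Num.sg (x - t)) = F T - F t.
  rewrite -FTC// -!Rintegral_itv_obnd_cbnd.
  - apply: eq_Rintegral => x; rewrite inE/= in_itv/= => /andP[tx _].
    by rewrite gtr0_sg ?subr_gt0// mulr1.
  - by apply: integrableS (fi t T) => // y /=; rewrite !in_itv/= => /andP[/ltW -> ->].
  - apply: integrableS isg => // y /=; rewrite !in_itv/= => /andP[ty ->].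
    by rewrite andbT (le_trans t0)// ltW.
ring.
Qed.

End ComplexIntegrals.

(** * Fourier integrals on the circle *)

Section CircleIntegrals.
Variable R : realType.
Local Notation mu := (@lebesgue_measure R).

Definition expi (k t : R) : R[i] := cos (k * t) +i* sin (k * t).

Lemma expiD (k l t : R) : expi (k + l) t = expi k t * expi l t.
Proof. by rewrite /expi mulrDl cosD sinD; simpc; congr (_ +i* _); ring. Qed.

Lemma expi0 (t : R) : expi 0 t = 1.
Proof. by rewrite /expi mul0r cos0 sin0. Qed.

Lemma expi_at0 (k : R) : expi k 0 = 1.
Proof. by rewrite /expi mulr0 cos0 sin0. Qed.

Lemma expi_neq0 (k t : R) : expi k t != 0.
Proof.
apply/negP => /eqP e; have := expiD k (- k) t; rewrite subrr expi0 e mul0r => /eqP.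
by rewrite oner_eq0.
Qed.

Lemma expiN (k t : R) : expi (- k) t = (expi k t)^-1.
Proof.
apply: (mulfI (expi_neq0 k t)).
by rewrite -expiD subrr expi0 mulfV// expi_neq0.
Qed.

Lemma e_X (n : nat) (t : R) : e_ t ^+ n = expi n%:R t.
Proof.
elim: n => [|n IH]; first by rewrite expi0.
by rewrite exprSr IH -natr1 expiD /e_ /expi mul1r.
Qed.

Lemma normc_e_ (t : R) : Normc.normc (e_ t) = 1.
Proof. by rewrite /e_ /= cos2Dsin2 sqrtr1. Qed.

Lemma cos_natr_pi2 (n : nat) : cos (n%:R * (2 * pi) : R) = 1 /\ sin (n%:R * (2 * pi) : R) = 0.
Proof.
have [c2 s2] : cos (2 * pi : R) = 1 /\ sin (2 * pi : R) = 0.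
  by rewrite mulr_natl cos2pi sin2pi.
elim: n => [|n [IHc IHs]]; first by rewrite mul0r cos0 sin0.
by rewrite -natr1 mulrDl mul1r cosD sinD IHc IHs c2 s2 !mulr1 !mulr0 subr0 addr0.
Qed.

Lemma expi_2pi (a b : nat) : expi (a%:R - b%:R) (2 * pi) = 1 :> R[i].
Proof.
by rewrite expiD expiN /expi !(cos_natr_pi2 _).1 !(cos_natr_pi2 _).2 divr1.
Qed.

(** This is 1 / (ik) for nonzero k, the factor in the primitive of exp(ikt). *)
Definition expi_coef (k : R) : R[i] := 0 +i* (- k^-1).

Definition expi_prim (k t : R) : R[i] :=
  if k == 0 then t%:C else expi_coef k * expi k t.

Let is_derive_cosk (k t : R) : is_derive t (1 : R) (fun t => cos (k * t)) (- (k * sin (k * t))).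
Proof. by apply: is_derive_eq; rewrite /GRing.scale/=; ring. Qed.

Let is_derive_sink (k t : R) : is_derive t (1 : R) (fun t => sin (k * t)) (k * cos (k * t)).
Proof. by apply: is_derive_eq; rewrite /GRing.scale/=; ring. Qed.

Lemma Ccontinuous_expi (k : R) : Ccontinuous (expi k).
Proof.
by split => t; apply: differentiable_continuous; apply/derivable1_diffP;
  [have [] := is_derive_cosk k t|have [] := is_derive_sink k t].
Qed.

Lemma CcontinuousM (f g : R -> R[i]) : Ccontinuous f -> Ccontinuous g ->
  Ccontinuous (fun t => f t * g t).
Proof.
move=> [fr fi] [gr gi]; split => t.
  rewrite (_ : (fun x => complex.Re (f x * g x)) = (fun x => complex.Re (f x) * complex.Re (g x) - complex.Im (f x) * complex.Im (g x))).
    by apply: cvgB; apply: cvgM; [exact: fr|exact: gr|exact: fi|exact: gi].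
  by apply/funext => x; case: (f x) => a b; case: (g x).
rewrite (_ : (fun x => complex.Im (f x * g x)) = (fun x => complex.Re (f x) * complex.Im (g x) + complex.Im (f x) * complex.Re (g x))).
  by apply: cvgD; apply: cvgM; [exact: fr|exact: gi|exact: fi|exact: gr].
by apply/funext => x; case: (f x) => a b; case: (g x) => c d /=; ring.
Qed.

Lemma CcontinuousD (f g : R -> R[i]) : Ccontinuous f -> Ccontinuous g ->
  Ccontinuous (fun t => f t + g t).
Proof.
move=> [fr fi] [gr gi]; split => t.
  rewrite (_ : (fun x => complex.Re (f x + g x)) = (fun x => complex.Re (f x) + complex.Re (g x))).
    by apply: cvgD; [exact: fr|exact: gr].
  by apply/funext => x; case: (f x) => a b; case: (g x).
rewrite (_ : (fun x => complex.Im (f x + g x)) = (fun x => complex.Im (f x) + complex.Im (g x))).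
  by apply: cvgD; [exact: fi|exact: gi].
by apply/funext => x; case: (f x) => a b; case: (g x).
Qed.

Lemma Ccontinuous_cst (c : R[i]) : Ccontinuous (fun=> c).
Proof. by split => t; exact: cvg_cst. Qed.

Lemma Ccontinuous_id : Ccontinuous (fun t : R => t%:C).
Proof. by split => t /=; [exact: cvg_id|exact: cvg_cst]. Qed.

Lemma Ccontinuous_expi_prim (k : R) : Ccontinuous (expi_prim k).
Proof.
have [k0|k0] := boolP (k == 0).
  rewrite (_ : expi_prim k = (fun t => t%:C)); first exact: Ccontinuous_id.
  by apply/funext => t; rewrite /expi_prim k0.
rewrite (_ : expi_prim k = (fun t => expi_coef k * expi k t)); last first.
  by apply/funext => t; rewrite /expi_prim (negbTE k0).
by apply: CcontinuousM; [exact: Ccontinuous_cst|exact: Ccontinuous_expi].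
Qed.

Lemma expi_primP (k : R) : Cis_primitive (expi_prim k) (expi k).
Proof.
move=> t; rewrite /expi_prim; have [->|k0] := eqVneq k 0.
  by rewrite expi0 /=; split; [exact: is_derive_id|exact: is_derive_cst].
split.
  rewrite (_ : (fun x => complex.Re _) = (fun x => k^-1 * sin (k * x))); last first.
    by apply/funext => x; rewrite /expi_coef /expi /=; ring.
  apply: is_derive_eq; rewrite /GRing.scale/= mulr1; by field.
rewrite (_ : (fun x => complex.Im _) = (fun x => - k^-1 * cos (k * x))); last first.
  by apply/funext => x; rewrite /expi_coef /expi /=; ring.
apply: is_derive_eq; rewrite /GRing.scale/= mulr1; by field.
Qed.

Lemma Cintegrable_sg (f : R -> R[i]) (T t : R) : Ccontinuous f ->
  Cintegrable mu `[0, T] (fun x => f x * (Num.sg (x - t))%:C).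
Proof.
move=> [cr ci]; split.
  apply: eq_integrable (@integrable_sg R _ T t cr) => // x _ /=.
  by case: (f x) => a b /=; congr EFin; ring.
apply: eq_integrable (@integrable_sg R _ T t ci) => // x _ /=.
by case: (f x) => a b /=; congr EFin; ring.
Qed.

Lemma Cintegral_sg (F f : R -> R[i]) (T t : R) : Ccontinuous f ->
  Cis_primitive F f -> 0 <= t <= T ->
  Cintegral mu `[0, T] (fun x => f x * (Num.sg (x - t))%:C) = F T + F 0 - 2 * F t.
Proof.
move=> [cr ci] dF tT; rewrite /Cintegral.
transitivity ((\int[mu]_(x in `[0, T]) (complex.Re (f x) * Num.sg (x - t))) +i*
  (\int[mu]_(x in `[0, T]) (complex.Im (f x) * Num.sg (x - t)))).
  by congr (_ +i* _); apply: eq_Rintegral => x _; case: (f x) => a b /=; ring.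
rewrite (@Rintegral_sg R (fun x => complex.Re (F x)) _ T t cr (fun x => (dF x).1) tT).
rewrite (@Rintegral_sg R (fun x => complex.Im (F x)) _ T t ci (fun x => (dF x).2) tT).
by case: (F T) (F 0) (F t) => a b [c d] [e f'] /=; simpc; congr (_ +i* _); ring.
Qed.

Let pi2_ge0 : 0 <= 2 * pi :> R. Proof. by rewrite mulr_ge0// pi_ge0. Qed.

Lemma Cintegral_expi (a b : nat) :
  Cintegral mu `[0, 2 * pi] (expi (a%:R - b%:R)) = (a == b)%:R * (2 * pi)%:C.
Proof.
rewrite (@CintegralFTC2 R (expi_prim (a%:R - b%:R)))//; last 2 first.
- exact: Ccontinuous_expi.
- exact: expi_primP.
rewrite /expi_prim subr_eq0 eqr_nat; case: eqP => _; first by rewrite mul1r subr0.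
by rewrite expi_2pi expi_at0 subrr mul0r.
Qed.

(** The inner integral of the circle product: exp(iks) sgn(s - t) integrated in s over [0, 2 pi]. *)
Definition sg_expi (k t : R) : R[i] := expi_prim k (2 * pi) + expi_prim k 0 - 2 * expi_prim k t.

Lemma Ccontinuous_sg_expi (k : R) : Ccontinuous (sg_expi k).
Proof.
apply: CcontinuousD; first exact: Ccontinuous_cst.
rewrite (_ : (fun t => - _) = (fun t => - 2 * expi_prim k t)); last first.
  by apply/funext => t; rewrite mulNr.
by apply: CcontinuousM; [exact: Ccontinuous_cst|exact: Ccontinuous_expi_prim].
Qed.

(** The frequencies are shifted by m because tau contributes exp(-imt) on the circle. *)
Definition circle_kernel (m a b : nat) : R[i] :=
  Cintegral mu `[0, 2 * pi] (fun t => expi (a%:R - m%:R) t * sg_expi (b%:R - m%:R) t).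

(** At a nonzero integer frequency the inner integral is 2c - 2c exp(i(b - m)t). Its constant term
    meets the frequency a - m only for a = m, its exponential only for a + b = 2m. *)
Lemma circle_kernel_neq (m a b : nat) : b != m ->
  circle_kernel m a b = 2 * expi_coef (b%:R - m%:R) *
    (((a == m)%:R - ((a + b)%N == m.*2)%:R) * (2 * pi)%:C).
Proof.
move=> bm; have k0 : b%:R - m%:R != 0 :> R by rewrite subr_eq0 eqr_nat.
rewrite /circle_kernel /sg_expi /expi_prim (negbTE k0) expi_2pi expi_at0 !mulr1.
set c := expi_coef _.
transitivity (Cintegral mu `[0, 2 * pi] (fun t => 2 * c * expi (a%:R - m%:R) t +
    (- (2 * c)) * expi ((a + b)%:R - m.*2%:R) t)).
  apply: eq_Cintegral => t _.
  have -> : (a + b)%:R - m.*2%:R = (a%:R - m%:R) + (b%:R - m%:R) :> R.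
    by rewrite -addnn !natrD; ring.
  by rewrite [X in _ = _ + _ * X]expiD; ring.
rewrite CintegralD ?CintegralZ//; last 4 first.
- exact/Ccontinuous_integrable/Ccontinuous_expi.
- exact/Ccontinuous_integrable/Ccontinuous_expi.
- by apply: CintegrableZ => //; exact/Ccontinuous_integrable/Ccontinuous_expi.
- by apply: CintegrableZ => //; exact/Ccontinuous_integrable/Ccontinuous_expi.
by rewrite !Cintegral_expi; ring.
Qed.

Lemma Ccontinuous_circle (a m : nat) :
  Ccontinuous (fun t => expi (a%:R - m%:R) t * ((2 * pi)%:C + 0%:C - 2 * t%:C)).
Proof.
apply: CcontinuousM; first exact: Ccontinuous_expi.
apply: CcontinuousD; first exact: Ccontinuous_cst.
rewrite (_ : (fun t => - _) = (fun t => - 2 * t%:C)); last first.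
  by apply/funext => t; rewrite mulNr.
by apply: CcontinuousM; [exact: Ccontinuous_cst|exact: Ccontinuous_id].
Qed.

Lemma circle_kernel_eq (m a : nat) :
  circle_kernel m a m = if a == m then 0 else - (4 * pi)%:C * expi_coef (a%:R - m%:R).
Proof.
rewrite /circle_kernel /sg_expi /expi_prim !subrr eqxx.
case: (eqVneq a m) => [->|am].
  pose F (t : R) : R[i] := (2 * pi * t - t ^+ 2)%:C.
  rewrite (@CintegralFTC2 R F)//.
  - by rewrite /F; simpc; congr (_ +i* _); ring.
  - exact: Ccontinuous_circle.
  - move=> t; rewrite subrr expi0 mul1r; split; rewrite /=.
      by apply: is_derive_eq; rewrite /GRing.scale/=; ring.
    by apply: (is_derive_eq (is_derive_cst _ _ _)); ring.
have k0 : a%:R - m%:R != 0 :> R by rewrite subr_eq0 eqr_nat.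
have cc := Ccontinuous_circle a m.
have p2 := expi_2pi a m; move: p2 k0 cc.
set k := a%:R - m%:R => p2 k0 cc.
(* Integration by parts of exp(ikt) (2 pi - 2t): the primitive is exp(ikt) (2 pi - 2t) / (ik) - 2
   exp(ikt) / k^2, written in components. *)
pose F (t : R) : R[i] :=
  (sin (k * t) / k * (2 * pi - 2 * t) - 2 * cos (k * t) / k ^+ 2) +i*
  (- cos (k * t) / k * (2 * pi - 2 * t) - 2 * sin (k * t) / k ^+ 2).
rewrite (@CintegralFTC2 R F)//.
- move: p2; rewrite /F /expi => -[-> ->]; rewrite !mulr0 cos0 sin0 /expi_coef; simpc.
  by congr (_ +i* _); field.
- move=> t; rewrite /F /expi; split; rewrite /=.
    by apply: is_derive_eq; rewrite /GRing.scale/=; field.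
  by apply: is_derive_eq; rewrite /GRing.scale/=; field.
Qed.

End CircleIntegrals.

(** * The circle part of the skew product *)

Section SkewAlpha.
Variable R : realType.
Variable m : nat.
Local Notation mu := (@lebesgue_measure R).

Definition circle_weight : R := Num.sqrt (weight2 m (1 : R)).

Lemma tau_circle (t : R) : tau m.*2.+1 (e_ t) = circle_weight%:C * expi (- m%:R) t.
Proof. by rewrite tau_weight2E normc_e_ e_X expiN mulrC. Qed.

Lemma tau_circle_horner (p : {poly R[i]}) (t : R) : (size p <= m.*2.+1)%N ->
  tau m.*2.+1 (e_ t) * p.[e_ t] =
  \sum_(a < m.*2.+1) (p`_a * circle_weight%:C) * expi (a%:R - m%:R) t.
Proof.
move=> sp; rewrite (horner_coef_wide _ sp) mulr_sumr; apply: eq_bigr => a _.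
by rewrite tau_circle e_X expiD; ring.
Qed.

Definition alpha_kernel (a b : nat) : R[i] :=
  - ('i / 2) * (circle_weight ^+ 2)%:C * circle_kernel R m a b.

Lemma skew_alphaE (p q : {poly R[i]}) :
  (size p <= m.*2.+1)%N -> (size q <= m.*2.+1)%N ->
  skew_alpha m.*2.+1 p q =
  \sum_(a < m.*2.+1) \sum_(b < m.*2.+1) p`_a * q`_b * alpha_kernel a b.
Proof.
move=> sp sq; rewrite /skew_alpha.
have inner (t : R) : t \in `[0, 2 * pi] ->
    Cintegral mu `[0, 2 * pi] (fun t2 => tau m.*2.+1 (e_ t2) * p.[e_ t] * q.[e_ t2] *
      (Num.sg (t2 - t))%:C) =
    \sum_(b < m.*2.+1) (p.[e_ t] * (q`_b * circle_weight%:C)) * sg_expi (b%:R - m%:R) t.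
  move=> tI.
  transitivity (Cintegral mu `[0, 2 * pi] (fun t2 => \sum_(b < m.*2.+1)
      (p.[e_ t] * (q`_b * circle_weight%:C)) * (expi (b%:R - m%:R) t2 * (Num.sg (t2 - t))%:C))).
    apply: eq_Cintegral => t2 _.
    transitivity (p.[e_ t] * (tau m.*2.+1 (e_ t2) * q.[e_ t2]) * (Num.sg (t2 - t))%:C).
      by ring.
    rewrite tau_circle_horner// mulr_sumr mulr_suml; apply: eq_bigr => b _; ring.
  rewrite Cintegral_sum//; last first.
    by move=> b; apply: CintegrableZ => //; apply: Cintegrable_sg; exact: Ccontinuous_expi.
  apply: eq_bigr => b _; rewrite CintegralZ//; last first.
    by apply: Cintegrable_sg; exact: Ccontinuous_expi.
  rewrite (@Cintegral_sg R (expi_prim (b%:R - m%:R)))//.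
  - exact: Ccontinuous_expi.
  - exact: expi_primP.
set I := Cintegral _ _ _.
have -> : I = \sum_(a < m.*2.+1) \sum_(b < m.*2.+1)
    p`_a * q`_b * ((circle_weight ^+ 2)%:C * circle_kernel R m a b).
  rewrite {}/I.
  transitivity (Cintegral mu `[0, 2 * pi] (fun t => \sum_(a < m.*2.+1) \sum_(b < m.*2.+1)
      (p`_a * q`_b * (circle_weight ^+ 2)%:C) *
      (expi (a%:R - m%:R) t * sg_expi (b%:R - m%:R) t))).
    apply: eq_Cintegral => t tI; rewrite inner//.
    transitivity (\sum_(b < m.*2.+1) (tau m.*2.+1 (e_ t) * p.[e_ t]) *
        ((q`_b * circle_weight%:C) * sg_expi (b%:R - m%:R) t)).
      by rewrite mulr_sumr; apply: eq_bigr => b _; ring.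
    rewrite exchange_big; apply: eq_bigr => b _.
    rewrite tau_circle_horner// mulr_suml; apply: eq_bigr => a _.
    by rewrite expr2 rmorphM/=; ring.
  have ci a b : Cintegrable mu `[0, 2 * pi]
      (fun t : R => expi (a%:R - m%:R) t * sg_expi (b%:R - m%:R) t).
    apply: Ccontinuous_integrable; apply: CcontinuousM.
      exact: Ccontinuous_expi.
    exact: Ccontinuous_sg_expi.
  rewrite Cintegral_sum//; last first.
    by move=> a; apply: Cintegrable_sum => // b; exact: CintegrableZ.
  apply: eq_bigr => a _; rewrite Cintegral_sum//; last by move=> b; exact: CintegrableZ.
  by apply: eq_bigr => b _; rewrite CintegralZ// mulrA.
rewrite mulr_sumr; apply: eq_bigr => a _; rewrite mulr_sumr; apply: eq_bigr => b _.
by rewrite /alpha_kernel; ring.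
Qed.

(** Only frequency 0 survives a full turn, and the factor exp(-imt) of tau places it at the
    coefficient of x^m. *)
Lemma Cintegral_tau_horner (q : {poly R[i]}) : (size q <= m.*2.+1)%N ->
  Cintegral mu `[0, 2 * pi] (fun t => tau m.*2.+1 (e_ t) * q.[e_ t]) =
  q`_m * (circle_weight * (2 * pi))%:C.
Proof.
move=> sq.
transitivity (Cintegral mu `[0, 2 * pi] (fun t => \sum_(a < m.*2.+1)
    (q`_a * circle_weight%:C) * expi (a%:R - m%:R) t)).
  by apply: eq_Cintegral => t _; exact: tau_circle_horner.
have ci a : Cintegrable mu `[0, 2 * pi] (expi (a%:R - m%:R) : R -> R[i]).
  exact/Ccontinuous_integrable/Ccontinuous_expi.
rewrite Cintegral_sum//; last by move=> a; exact: CintegrableZ.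
have mN : (m < m.*2.+1)%N by lia.
rewrite (bigD1 (Ordinal mN))//= big1 ?addr0; last first.
  move=> a am; have am' : (a == m :> nat) = false.
    by apply/negbTE; apply: contra am => /eqP am; apply/eqP/val_inj.
  by rewrite CintegralZ// Cintegral_expi am' mul0r mulr0.
by rewrite CintegralZ// Cintegral_expi eqxx mul1r -mulrA -rmorphM.
Qed.

(** Antisymmetry is read off from the computed values, according to whether a or b equals m, instead
    of exchanging the two integrals. *)
Lemma alpha_kernelC (a b : nat) : alpha_kernel a b = - alpha_kernel b a.
Proof.
suff H : circle_kernel R m a b = - circle_kernel R m b a by rewrite /alpha_kernel H mulrN.
have cN (k : R) : expi_coef (- k) = - expi_coef k.
  by rewrite /expi_coef invrN opprK; apply/eqP; rewrite eq_complex /= oppr0 opprK !eqxx.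
case: (eqVneq a m) => [->|am]; case: (eqVneq b m) => [->|bm].
- by rewrite circle_kernel_eq eqxx oppr0.
- rewrite circle_kernel_neq// circle_kernel_eq (negbTE bm) eqxx.
  have -> : (m + b == m.*2)%N = false by apply/eqP; move/eqP: bm; lia.
  by rewrite subr0 mul1r mulNr opprK !rmorphM/= !rmorph_nat; ring.
- rewrite circle_kernel_eq (negbTE am) circle_kernel_neq// eqxx.
  have -> : (m + a == m.*2)%N = false by apply/eqP; move/eqP: am; lia.
  by rewrite subr0 mul1r mulNr !rmorphM/= !rmorph_nat; ring.
rewrite !circle_kernel_neq// (negbTE am) (negbTE bm) [(b + a)%N]addnC.
case: eqP => [abm|_]; last by rewrite subr0 !mul0r !mulr0 oppr0.
have -> : b%:R - m%:R = - (a%:R - m%:R) :> R.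
  have : (a + b)%:R = m.*2%:R :> R by rewrite abm.
  by rewrite natrD -addnn natrD => H; lra.
by rewrite cN; ring.
Qed.

Lemma alpha_kernel_eq0 (a b : nat) : a != m -> b != m -> (a + b)%N != m.*2 ->
  alpha_kernel a b = 0.
Proof.
move=> am bm abm; rewrite /alpha_kernel circle_kernel_neq// (negbTE am) (negbTE abm).
by rewrite subrr mul0r !mulr0.
Qed.

Lemma sqr_circle_weight : circle_weight ^+ 2 = beta_sum R m m / (2 * Num.sqrt pi).
Proof.
rewrite /circle_weight sqr_sqrtr ?weight2_ge0// weight2_1 invfM.
by rewrite mulrC -mulrA.
Qed.

Lemma alpha_kernelE (a b : nat) : (a + b)%N = m.*2 -> a != m ->
  alpha_kernel a b = (Num.sqrt pi * beta_sum R m m / (m%:R - a%:R))%:C.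
Proof.
move=> abm am; have bm : b != m by apply/eqP; move/eqP: am; lia.
rewrite /alpha_kernel circle_kernel_neq// (negbTE am) abm eqxx sub0r mulN1r.
rewrite sqr_circle_weight.
have -> : b%:R - m%:R = m%:R - a%:R :> R.
  have : (a + b)%:R = m.*2%:R :> R by rewrite abm.
  by rewrite natrD -addnn natrD => H; lra.
have k0 : m%:R - a%:R != 0 :> R by rewrite subr_eq0 eqr_nat eq_sym.
have sp : Num.sqrt pi != 0 :> R by rewrite gt_eqF// sqrtr_gt0 pi_gt0.
have pE : pi = Num.sqrt pi ^+ 2 :> R by rewrite sqr_sqrtr// pi_ge0.
rewrite [in (2 * pi)%:C]pE /expi_coef.
have -> : (2 : R[i]) = (2 : R)%:C by rewrite rmorph_nat.
rewrite -fmorphV /=; simpc.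
congr (_ +i* _); field.
by rewrite k0 sp.
Qed.

End SkewAlpha.

(** * Integrals over the disc *)

Section DiscIntegrals.
Variable R : realType.
Local Notation mu := (@lebesgue_measure R).

Definition rnorm (z : R * R) : R := Num.sqrt (z.1 ^+ 2 + z.2 ^+ 2).
Definition disc : set (R * R) := [set z | rnorm z < 1].

Lemma rnorm_polar (r t : R) : 0 <= r -> rnorm (r * cos t, r * sin t) = r.
Proof.
by move=> r0; rewrite /rnorm /= !exprMn -mulrDr cos2Dsin2 mulr1 sqrtr_sqr ger0_norm.
Qed.

Lemma measurable_rnorm : measurable_fun setT rnorm.
Proof.
apply: (@measurableT_comp _ _ _ _ _ _ (@Num.sqrt R)).
  by apply: continuous_measurable_fun => x; exact: sqrt_continuous.
by apply: measurable_funD; apply: measurable_funX.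
Qed.

Lemma measurable_disc : measurable disc.
Proof.
have -> : disc = rnorm @^-1` `]-oo, 1[ by apply/seteqP; split => z /=; rewrite in_itv.
by rewrite -[_ @^-1` _]setTI; apply: measurable_rnorm.
Qed.

(** For slope t, atan t runs over one half-turn and atan t + pi over the other. Together they cover
    the angles from -pi/2 to 3 pi/2, the endpoints at which B is evaluated. *)
Lemma ge0_integral_disc (f : R * R -> R) (g A B : R -> R) (G : R) :
  measurable_fun setT f ->
  (forall z, disc z -> 0 <= f z) ->
  (forall r t, 0 < r < 1 -> f (r * cos t, r * sin t) = g r * A t) ->
  (forall t : R, is_derive t (1 : R) B (A t)) -> continuous A ->
  (forall t, 0 <= A t) -> 0 <= G ->
  measurable_fun (`]0, 1[%classic : set R) g -> (forall r, 0 < r < 1 -> 0 <= g r) ->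
  (\int[mu]_(r in `]0%R, 1%R[) (r * g r)%:E = G%:E)%E ->
  (\int[mu \x mu]_(z in disc) (f z)%:E =
    ((B (3 * pi / 2) - B (- (pi / 2))) * G)%:E)%E.
Proof.
move=> mf f0 fgA dB cA A0 G0 mg g0 gG.
have mfD : measurable_fun setT ((fun z => (f z)%:E) \_ disc).
  apply/(measurable_restrictT (fun z => (f z)%:E) measurable_disc).
  by apply: measurable_funTS; exact/measurable_EFinP.
rewrite integral_mkcond ge0_integral_polar; last 2 first.
- exact: mfD.
- move=> z; rewrite patchE; case: ifPn => // /set_mem zD.
  by rewrite lee_fin f0.
pose h (t : R) := (1 + t ^+ 2)^-1 * (A (atan t) + A (atan t + pi)) * G.
transitivity (\int[mu]_t (h t)%:E)%E.
  apply: eq_integral => t _; rewrite /h -mulrA EFinM; congr (_ * _)%E.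
  rewrite EFinM -gG -ge0_integralZl_EFin//; last 3 first.
  - move=> r; rewrite /= in_itv/= => /andP[r0 r1].
    by rewrite lee_fin mulr_ge0 ?g0 ?r0// ltW.
  - by apply/measurable_EFinP; exact: measurable_funM.
  - by rewrite addr_ge0.
  rewrite [LHS]integral_mkcond [RHS]integral_mkcond; apply: eq_integral => r _.
  rewrite [in LHS]patchE [in RHS]patchE !mem_setE/= !in_itv/= andbT.
  have dP t' : 0 < r -> ((r * cos t', r * sin t') \in disc) = (r < 1).
    move=> r0; apply/idP/idP.
      by move/set_mem; rewrite /disc /= rnorm_polar// ltW.
    by move=> r1; apply/mem_set; rewrite /disc /= rnorm_polar// ltW.
  case: (ltP 0 r) => r0 //=.
  rewrite !patchE !dP//; case: (ltP r 1) => r1 /=; last by rewrite adde0 mule0.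
  by rewrite !fgA ?r0// -!EFinD -!EFinM; congr EFin; ring.
pose H (t : R) := G * (B (atan t) + B (atan t + pi)).
have da (t : R) : is_derive t (1 : R) (@atan R) (1 + t ^+ 2)^-1.
  by apply: DeriveDef; [exact: derivable_atan|rewrite -derive1E derive1_atan].
have dH (t : R) : is_derive t (1 : R) H (h t).
  have d1 := @is_derive1_comp R B (@atan R) t _ _ (dB _) (da t).
  have dap := @is_deriveD R R R (@atan R) (cst pi) t (1 : R) _ _ (da t) (is_derive_cst _ _ _).
  have d2 := @is_derive1_comp R B _ t _ _ (dB (atan t + pi)) dap.
  have d12 := @is_deriveD R R R _ _ t (1 : R) _ _ d1 d2.
  apply: (is_derive_eq (is_deriveZ G d12)).
  by rewrite /GRing.scale/= /h addr0; ring.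
have cB : continuous B.
  by move=> t; apply: differentiable_continuous; apply/derivable1_diffP; have [] := dB t.
have ch : continuous h.
  move=> t; apply: cvgM; last exact: cvg_cst.
  apply: cvgM.
    apply: cvgV; first by rewrite gt_eqF// ltr_pwDl// sqr_ge0.
    exact: continuous_onedsqr.
  apply: cvgD.
    by apply: (@continuous_comp _ _ _ (@atan R) A); [exact: continuous_atan|exact: cA].
  apply: (@continuous_comp _ _ _ (fun t => atan t + pi) A); last exact: cA.
  by apply: cvgD; [exact: continuous_atan|exact: cvg_cst].
have h0 t : 0 <= h t.
  by rewrite /h !mulr_ge0 ?addr_ge0// invr_ge0 addr_ge0 ?sqr_ge0.
rewrite integral_itv_cy0; last 2 first.
- by apply/measurable_EFinP; exact: continuous_measurable_fun.
- by move=> t; rewrite lee_fin.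
have chN : continuous (fun t => h (- t)).
  by move=> t; apply: (@continuous_comp _ _ _ (fun t : R => - t) h); [exact: cvgN|exact: ch].
rewrite integral_itv_obnd_cbnd; last first.
  apply: measurable_funTS; apply: emeasurable_funD; apply/measurable_EFinP;
    exact: continuous_measurable_fun.
have dHN (t : R) : is_derive t (1 : R) (fun t => H t - H (- t)) (h t + h (- t)).
  have dn : is_derive t (1 : R) (fun t : R => - t) (-1) by apply: is_derive_eq.
  have d2 := @is_derive1_comp R H (fun t : R => - t) t _ _ (dH (- t)) dn.
  apply: (is_derive_eq (@is_deriveB R R R _ _ t (1 : R) _ _ (dH t) d2)).
  by rewrite mulrN1 opprK.
transitivity (\int[mu]_(t in `[0%R, +oo[) (h t + h (- t))%:E)%E.
  by apply: eq_integral => t _; rewrite EFinD.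
(* The limit of H(t) - H(-t) as t tends to infinity. The two occurrences of B (pi/2) cancel, which
   leaves the ends of one full turn. *)
pose l := G * (B (pi / 2) + B (pi / 2 + pi)) - G * (B (- (pi / 2)) + B (- (pi / 2) + pi)).
rewrite (@ge0_integral_FTC2y R (fun t => H t - H (- t)) _ 0 l (fun t _ => dHN t)).
- congr EFin; rewrite /l oppr0 subrr subr0.
  have -> : pi / 2 + pi = 3 * pi / 2 :> R by field.
  have -> : - (pi / 2) + pi = pi / 2 :> R by field.
  by ring.
- by move=> t _; apply: cvgD; [exact: ch|exact: chN].
- by move=> t _; rewrite addr_ge0.
have cBB (x : R) : {for x, continuous (fun x => G * (B x + B (x + pi)))}.
  apply: cvgM; first exact: cvg_cst.
  apply: cvgD; first exact: cB.
  apply: (@continuous_comp _ _ _ (fun x => x + pi) B); last exact: cB.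
  by apply: cvgD; [exact: cvg_id|exact: cvg_cst].
apply: cvgB.
  by apply: (@cvg_comp _ _ _ (@atan R) (fun x => G * (B x + B (x + pi)))); [exact: cvgy_atan|exact: cBB].
rewrite (_ : (fun t => H (- t)) = (fun t => (fun x => G * (B (- x) + B (- x + pi))) (atan t))); last first.
  by apply/funext => t; rewrite /H atanN.
apply: (@cvg_comp _ _ _ (@atan R) (fun x => G * (B (- x) + B (- x + pi)))); first exact: cvgy_atan.
apply: (@continuous_comp _ _ _ (fun x : R => - x) (fun x => G * (B x + B (x + pi)))); last exact: cBB.
exact: cvgN.
Qed.

(* The angular factor is made nonnegative by adding 1, so that the dominating
   function g need only be integrable. *)
Lemma integral_disc (f : R * R -> R) (g A B : R -> R) (G : R) :
  measurable_fun setT f -> measurable_fun setT g ->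
  (forall r, 0 <= r < 1 -> 0 <= g r) ->
  (forall z, disc z -> `|f z| <= g (rnorm z)) ->
  (forall r t, 0 < r < 1 -> f (r * cos t, r * sin t) = g r * A t) ->
  (forall t : R, is_derive t (1 : R) B (A t)) -> continuous A ->
  (forall t, `|A t| <= 1) ->
  (\int[mu]_(r in `]0%R, 1%R[) (r * g r)%:E = G%:E)%E ->
  (mu \x mu)%E.-integrable disc (EFin \o f) /\
  \int[(mu \x mu)%E]_(z in disc) f z = (B (3 * pi / 2) - B (- (pi / 2))) * G.
Proof.
move=> mf mg g0 fg fgA dB cA A1 gG.
have g0' r : 0 < r < 1 -> 0 <= g r by move=> /andP[r0 r1]; rewrite g0// r1 ltW.
have G0 : 0 <= G.
  rewrite -lee_fin -gG; apply: integral_ge0 => r; rewrite /= in_itv/= => r01.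
  by rewrite lee_fin mulr_ge0 ?g0'//; case/andP: r01 => /ltW.
have mgn : measurable_fun setT (g \o rnorm).
  by apply: measurableT_comp => //; exact: measurable_rnorm.
have gn0 z : disc z -> 0 <= g (rnorm z).
  by move=> zD; rewrite g0// sqrtr_ge0.
have mg' : measurable_fun (`]0, 1[%classic : set R) g by exact: measurable_funTS.
(* The case A = 1 gives the integrability of the dominating function and is subtracted at the
   end. *)
have I0 := @ge0_integral_disc (g \o rnorm) g (cst 1) id G mgn gn0.
have {}I0 : (\int[mu \x mu]_(z in disc) (g (rnorm z))%:E =
    ((3 * pi / 2 + pi / 2) * G)%:E)%E.
  rewrite I0 ?opprK//.
  - by move=> r t /andP[r0 _]; rewrite /= rnorm_polar ?mulr1// ltW.
  - by move=> t; exact: cvg_cst.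
have I1 : (\int[mu \x mu]_(z in disc) (g (rnorm z) + f z)%:E =
    ((3 * pi / 2 + B (3 * pi / 2) - (- (pi / 2) + B (- (pi / 2)))) * G)%:E)%E.
  rewrite (@ge0_integral_disc _ g (fun t => 1 + A t) (fun t => t + B t) G)//.
  - exact: measurable_funD.
  - by move=> z zD; have := fg z zD; rewrite ler_norml => /andP[]; lra.
  - by move=> r t /andP[r0 r1]; rewrite rnorm_polar ?ltW// fgA ?r0//; ring.
  - by move=> t; apply: cvgD; [exact: cvg_cst|exact: cA].
  - by move=> t; have := A1 t; rewrite ler_norml => /andP[]; lra.
have i0 : (mu \x mu)%E.-integrable disc (EFin \o (g \o rnorm)).
  apply/integrableP; split.
    by apply/measurable_EFinP; exact: measurable_funTS.
  have -> : (\int[mu \x mu]_(z in disc) `|(EFin \o (g \o rnorm)) z| =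
      \int[mu \x mu]_(z in disc) (g (rnorm z))%:E)%E.
    by apply: eq_integral => z /set_mem zD /=; rewrite ger0_norm// gn0.
  by rewrite I0 ltry.
have fi : (mu \x mu)%E.-integrable disc (EFin \o f).
  apply: le_integrable i0; first exact: measurable_disc.
    by apply/measurable_EFinP; exact: measurable_funTS.
  by move=> z zD; rewrite /= lee_fin (le_trans (fg z zD))// ler_norm.
split => //.
have : \int[(mu \x mu)%E]_(z in disc) (g (rnorm z) + f z) =
    \int[(mu \x mu)%E]_(z in disc) (g (rnorm z)) + \int[(mu \x mu)%E]_(z in disc) f z.
  by rewrite RintegralD//; exact: measurable_disc.
rewrite /Rintegral I0 I1 /= => H.
by apply: (addrI ((3 * pi / 2 + pi / 2) * G)); rewrite -H; ring.
Qed.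

End DiscIntegrals.

(** * The disc part of the skew product *)

Section SkewBeta.
Variable R : realType.
Variable m : nat.
Local Notation mu := (@lebesgue_measure R).

Definition cplx (z : R * R) : R[i] := z.1 +i* z.2.

Lemma normc_cplx z : Normc.normc (cplx z) = rnorm z. Proof. by []. Qed.

Lemma cplx_polar (r t : R) : cplx (r * cos t, r * sin t) = r%:C * expi 1 t.
Proof. by rewrite /cplx /expi mul1r; simpc. Qed.

Lemma expi1X (n : nat) (k t : R) : expi k t ^+ n = expi (n%:R * k) t.
Proof.
elim: n => [|n IH]; first by rewrite mul0r expi0.
by rewrite exprSr IH -natr1 mulrDl mul1r expiD.
Qed.

Lemma normcX (x : R[i]) n : Normc.normc (x ^+ n) = Normc.normc x ^+ n.
Proof.
elim: n => [|n IH]; first by rewrite !expr0 /= expr1n expr0n addr0 sqrtr1.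
by rewrite !exprS Normc.normcM IH.
Qed.

Lemma normc_conjc (x : R[i]) : Normc.normc (conjc x) = Normc.normc x.
Proof. by case: x => a b /=; rewrite sqrrN. Qed.

Lemma ler_Re_normc (x : R[i]) : `|complex.Re x| <= Normc.normc x.
Proof.
by case: x => a b /=; rewrite -sqrtr_sqr ler_wsqrtr// lerDl sqr_ge0.
Qed.

Lemma ler_Im_normc (x : R[i]) : `|complex.Im x| <= Normc.normc x.
Proof.
by case: x => a b /=; rewrite -sqrtr_sqr ler_wsqrtr// lerDr sqr_ge0.
Qed.

Definition Cmeasurable (f : R * R -> R[i]) : Prop :=
  measurable_fun setT (fun z => complex.Re (f z)) /\
  measurable_fun setT (fun z => complex.Im (f z)).

Lemma CmeasurableM (f g : R * R -> R[i]) : Cmeasurable f -> Cmeasurable g ->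
  Cmeasurable (fun z => f z * g z).
Proof.
move=> [fr fi] [gr gi]; split.
  rewrite (_ : (fun x => complex.Re (f x * g x)) = (fun x => complex.Re (f x) * complex.Re (g x) - complex.Im (f x) * complex.Im (g x))).
    by apply: measurable_funB; exact: measurable_funM.
  by apply/funext => x; case: (f x) => a b; case: (g x).
rewrite (_ : (fun x => complex.Im (f x * g x)) = (fun x => complex.Re (f x) * complex.Im (g x) + complex.Im (f x) * complex.Re (g x))).
  by apply: measurable_funD; exact: measurable_funM.
by apply/funext => x; case: (f x) => a b; case: (g x) => c d /=; ring.
Qed.

Lemma CmeasurableX (f : R * R -> R[i]) n : Cmeasurable f ->
  Cmeasurable (fun z => f z ^+ n).
Proof.
move=> mf; elim: n => [|n IH]; first by split; exact: measurable_cst.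
rewrite (_ : (fun z => f z ^+ n.+1) = (fun z => f z * f z ^+ n)).
  exact: CmeasurableM.
by apply/funext => z; rewrite exprS.
Qed.

(* In polar coordinates: V(r^2) r^e exp(i (n - l) t). The real power [`^ (-1)]
   makes the inverse of the norm measurable by a library lemma. *)
Definition disc_wave (e n l : nat) (z : R * R) : R[i] :=
  (radial_V m (rnorm z ^+ 2) * rnorm z ^+ e * (rnorm z `^ (-1)) ^+ (n + l))%:C *
  (cplx z ^+ n * conjc (cplx z) ^+ l).

(** Continuity of V is established for s >= 0; the absolute value extends it to a function
    continuous on the whole line. *)
Lemma measurable_radial_V_norm : measurable_fun setT (fun r : R => radial_V m `|r|).
Proof.
apply: continuous_measurable_fun => r.
apply: (@continuous_comp _ _ _ (fun r : R => `|r|) (radial_V m)).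
  exact: norm_continuous.
exact: continuous_radial_V.
Qed.

Lemma measurable_radial_V_sqr : measurable_fun setT (fun r : R => radial_V m (r ^+ 2)).
Proof.
rewrite (_ : (fun r => _) = (fun r : R => radial_V m `|r|) \o (fun r => r ^+ 2)).
  by apply: measurableT_comp; [exact: measurable_radial_V_norm|exact: exprn_measurable].
by apply/funext => r /=; rewrite ger0_norm ?sqr_ge0.
Qed.

Lemma Cmeasurable_disc_wave e n l : Cmeasurable (disc_wave e n l).
Proof.
apply: CmeasurableM.
  split; last exact: measurable_cst.
  apply: measurable_funM; first apply: measurable_funM.
  - by apply: (measurableT_comp measurable_radial_V_sqr); exact: measurable_rnorm.
  - by apply: measurable_funX; exact: measurable_rnorm.
  - apply: measurable_funX.
    apply: (@measurableT_comp _ _ _ _ _ _ (fun r : R => r `^ (-1))).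
      exact: measurable_powR.
    exact: measurable_rnorm.
apply: CmeasurableM; apply: CmeasurableX; split.
- exact: measurable_fst.
- exact: measurable_snd.
- exact: measurable_fst.
- by apply: measurableT_comp => //; exact: measurable_snd.
Qed.

Lemma radial_V_sqr_ge0 (r : R) : 0 <= r < 1 -> 0 <= radial_V m (r ^+ 2).
Proof.
move=> /andP[]; rewrite le_eqVlt => /predU1P[<- _|r0 r1]; last first.
  by rewrite radial_V_ge0// ltW.
(* The positivity coming from [weight2] needs r > 0. At r = 0 the differential equation gives (m +
   1) V(0) = q(0)^(2m+2) / 2. *)
have := @radial_V_ode R m 0 (lexx 0); rewrite mul0r => /esym/eqP.
rewrite subr_eq0 expr0n /= => /eqP H.
rewrite -(pmulr_rge0 _ (_ : 0 < m.+1%:R)) ?ltr0n// -H.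
by rewrite divr_ge0// exprn_ge0// ltW// radial_q_gt0.
Qed.

Lemma disc_wave_polar e n l (r t : R) : 0 < r < 1 ->
  disc_wave e n l (r * cos t, r * sin t) =
  (radial_V m (r ^+ 2) * r ^+ e)%:C * expi (n%:R - l%:R) t.
Proof.
move=> /andP[r0 r1]; rewrite /disc_wave rnorm_polar ?ltW// cplx_polar.
have cj : conjc (r%:C * expi 1 t) = r%:C * expi (-1) t.
  by rewrite /expi mul1r mulN1r cosN sinN; simpc.
rewrite powR_inv1 ?ltW// cj !exprMn !expi1X mulr1 mulrN1 expiD.
have one : (r^-1 ^+ (n + l))%:C * (r%:C ^+ n * r%:C ^+ l) = 1.
  by rewrite -exprD -rmorphXn -rmorphM -exprMn mulVf ?gt_eqF// expr1n.
transitivity ((radial_V m (r ^+ 2) * r ^+ e)%:C *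
    ((r^-1 ^+ (n + l))%:C * (r%:C ^+ n * r%:C ^+ l)) * (expi n%:R t * expi (- l%:R) t)).
  by rewrite rmorphM; ring.
by rewrite one mulr1.
Qed.

(** Off the origin the powers of |z| and of its inverse cancel. At the origin the inverse is 0 by
    convention, which makes this an inequality. *)
Lemma normc_disc_wave e n l z : disc z ->
  Normc.normc (disc_wave e n l z) <= radial_V m (rnorm z ^+ 2) * rnorm z ^+ e.
Proof.
move=> zD; have r0 : 0 <= rnorm z by exact: sqrtr_ge0.
have V0 : 0 <= radial_V m (rnorm z ^+ 2) * rnorm z ^+ e.
  by rewrite mulr_ge0 ?exprn_ge0// radial_V_sqr_ge0// r0.
rewrite /disc_wave !Normc.normcM !normcX normc_conjc normc_cplx.
have -> : Normc.normc (radial_V m (rnorm z ^+ 2) * rnorm z ^+ e * rnorm z `^ (-1) ^+ (n + l))%:C =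
    radial_V m (rnorm z ^+ 2) * rnorm z ^+ e * rnorm z `^ (-1) ^+ (n + l).
  by rewrite /= expr0n addr0 sqrtr_sqr ger0_norm// mulr_ge0 ?exprn_ge0// powR_ge0.
rewrite -[X in X <= _]mulrA -exprD -exprMn powR_inv1//.
apply: ler_piMr => //; rewrite exprn_ile1//.
  by rewrite mulr_ge0// invr_ge0.
by have [->|rn0] := eqVneq (rnorm z) 0; rewrite ?mulr0// mulVf.
Qed.

Lemma integral_radial_moment e :
  (\int[mu]_(r in `]0%R, 1%R[) (r * (radial_V m (r ^+ 2) * r ^+ e))%:E =
   (radial_moment R m e)%:E)%E.
Proof.
rewrite /radial_moment /Rintegral fineK; last first.
  by apply: integrable_fin_num => //; exact: integrable_radial_moment.
have mF : measurable_fun setT (fun r : R => (r * (radial_V m (r ^+ 2) * r ^+ e))%:E).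
  apply/measurable_EFinP; apply: measurable_funM => //.
  by apply: measurable_funM => //; exact: measurable_radial_V_sqr.
rewrite integral_itv_bndo_bndc; last exact: measurable_funTS.
by rewrite integral_itv_obnd_cbnd//; exact: measurable_funTS.
Qed.

Let cos_max (t : R) : `|cos t| <= 1.
Proof. by rewrite ler_norml cos_geN1 cos_le1. Qed.

Let sin_max (t : R) : `|sin t| <= 1.
Proof. by rewrite ler_norml sin_geN1 sin_le1. Qed.

Lemma Cintegral_disc_wave e n l :
  Cintegrable (mu \x mu)%E (@disc R) (disc_wave e n l) /\
  Cintegral (mu \x mu)%E (@disc R) (disc_wave e n l) =
    (n == l)%:R * (2 * pi * radial_moment R m e)%:C.
Proof.
have [mr mi] := Cmeasurable_disc_wave e n l.
have mg : measurable_fun setT (fun r : R => radial_V m (r ^+ 2) * r ^+ e).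
  by apply: measurable_funM => //; exact: measurable_radial_V_sqr.
have g0 (r : R) : 0 <= r < 1 -> 0 <= radial_V m (r ^+ 2) * r ^+ e.
  by move=> r01; rewrite mulr_ge0 ?radial_V_sqr_ge0// exprn_ge0//; case/andP: r01.
have [cr ci] := Ccontinuous_expi (n%:R - l%:R : R).
have pr (r t : R) : 0 < r < 1 -> complex.Re (disc_wave e n l (r * cos t, r * sin t)) =
    radial_V m (r ^+ 2) * r ^+ e * complex.Re (expi (n%:R - l%:R) t).
  by move=> r01; rewrite disc_wave_polar//= mul0r subr0.
have pim (r t : R) : 0 < r < 1 -> complex.Im (disc_wave e n l (r * cos t, r * sin t)) =
    radial_V m (r ^+ 2) * r ^+ e * complex.Im (expi (n%:R - l%:R) t).
  by move=> r01; rewrite disc_wave_polar//= mul0r addr0.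
have [ir Er] := @integral_disc R _ _ (fun t => complex.Re (expi (n%:R - l%:R) t))
    (fun t => complex.Re (expi_prim (n%:R - l%:R) t)) _ mr mg g0
    (fun z zD => le_trans (ler_Re_normc _) (normc_disc_wave e n l zD)) pr
    (fun t => (expi_primP (n%:R - l%:R) t).1) cr
    (fun t => cos_max _) (integral_radial_moment e).
have [ii Ei] := @integral_disc R _ _ (fun t => complex.Im (expi (n%:R - l%:R) t))
    (fun t => complex.Im (expi_prim (n%:R - l%:R) t)) _ mi mg g0
    (fun z zD => le_trans (ler_Im_normc _) (normc_disc_wave e n l zD)) pim
    (fun t => (expi_primP (n%:R - l%:R) t).2) ci
    (fun t => sin_max _) (integral_radial_moment e).
split => //; rewrite /Cintegral Er Ei.
(* The two angles differ by a full turn: the primitive is periodic unless n = l, in which case it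
   grows by 2 pi. *)
have -> : expi_prim (n%:R - l%:R) (3 * pi / 2) =
    expi_prim (n%:R - l%:R) (- (pi / 2)) + (n == l)%:R * (2 * pi)%:C :> R[i].
  rewrite /expi_prim subr_eq0 eqr_nat; case: eqP => _.
    by rewrite mul1r -rmorphD; congr (_%:C); field.
  rewrite mul0r addr0; congr (_ * _).
  have := expi_2pi R n l; rewrite /expi => -[c1 s1].
  have -> : (n%:R - l%:R) * (3 * pi / 2) = (n%:R - l%:R) * (- (pi / 2)) + (n%:R - l%:R) * (2 * pi) :> R.
    by field.
  by rewrite cosD sinD c1 s1 !mulr1 !mulr0 subr0 addr0.
case: (n == l); case: (expi_prim _ _) => u v /=; simpc; congr (_ +i* _); ring.
Qed.

(** Used with c = conj(w) and r = |w|. Both sides have modulus r^(2m+a-b) and angular frequency a +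
    b - 2m; on the right w and c carry nonnegative powers only, as in [disc_wave] with n = a + b and
    l = 2m. *)
Lemma wave_term (w c r : R[i]) (a b : nat) : w != 0 -> c != 0 -> w * c = r ^+ 2 ->
  (b <= m.*2)%N ->
  w ^- m * c ^+ m * r ^+ m.*2 * (w ^+ a / c ^+ b) =
  r ^+ (m.*2 + a - b) * r^-1 ^+ (a + b + m.*2) * (w ^+ (a + b) * c ^+ m.*2).
Proof.
move=> w0 c0 wc bm.
have r0 : r != 0.
  by apply/eqP => r0; move/eqP: wc; rewrite r0 expr0n mulf_eq0 (negbTE w0) (negbTE c0).
have rX n : r ^+ n.*2 = w ^+ n * c ^+ n by rewrite -mul2n exprM -wc exprMn.
have -> : (a + b + m.*2)%N = (m.*2 + a - b + b.*2)%N by lia.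
rewrite exprVn [r ^+ (_ + b.*2)]exprD !rX [w ^+ (a + b)]exprD -addnn [c ^+ (m + m)]exprD.
field.
by rewrite !expf_neq0.
Qed.

Definition beta_kernel (a b : nat) : R[i] :=
  ((Num.sqrt pi)^-1)%:C * (((a + b)%N == m.*2)%:R *
    ((2 * pi * radial_moment R m (m.*2 + a - b))%:C -
     (2 * pi * radial_moment R m (m.*2 + b - a))%:C)).

Definition beta_weight (z : R * R) : R[i] :=
  let w := cplx z in let w' := (w^*)^-1 in
  tau m.*2.+1 w * tau m.*2.+1 w' * ((Normc.normc w ^+ 2)^-1)%:C.

Lemma beta_weightE (z : R * R) (a b : nat) : disc z -> (a <= m.*2)%N -> (b <= m.*2)%N ->
  let w := cplx z in let w' := (w^*)^-1 in
  beta_weight z * (w ^+ a * w' ^+ b - w ^+ b * w' ^+ a) =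
  ((Num.sqrt pi)^-1)%:C * (disc_wave (m.*2 + a - b) (a + b) m.*2 z -
    disc_wave (m.*2 + b - a) (a + b) m.*2 z).
Proof.
move=> zD am bm w w'; rewrite /beta_weight -/w -/w' normc_cplx.
have rE : Normc.normc w = rnorm z by [].
(* At the origin the left side vanishes because 1 / |w|^2 is 0 by convention. On the right the
   factor 0^(2m) does it, except for m = 0, where a = b = 0 and the difference is zero. *)
have [w0|w0] := eqVneq w 0.
  have r0 : rnorm z = 0 by rewrite -rE w0 /= expr0n addr0 sqrtr0.
  rewrite r0 expr0n invr0 mulr0 mul0r.
  have [m0|m0] := posnP m.
    have -> : a = 0%N by move: am; rewrite m0; lia.
    have -> : b = 0%N by move: bm; rewrite m0; lia.
    by rewrite subrr mulr0.
  by rewrite /disc_wave -/w w0 conjc0 [0 ^+ m.*2]expr0n double_eq0 (gtn_eqF m0) !mulr0 subrr mulr0.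
pose c : R[i] := conjc w.
have w'E : w' = c^-1 by [].
have c0 : c != 0 by rewrite conjc_eq0.
have r0 : 0 < rnorm z.
  rewrite lt_neqAle sqrtr_ge0 andbT eq_sym -rE; apply/eqP => /Normc.eq0_normc e.
  by rewrite e eqxx in w0.
have wc : w * c = (rnorm z)%:C ^+ 2.
  rewrite -rE /c; case: (w) => x y /=; rewrite -rmorphXn sqr_sqrtr ?addr_ge0 ?sqr_ge0//.
  by simpc; congr (_ +i* _); ring.
have rV : Normc.normc w' = (rnorm z)^-1.
  have : Normc.normc (w' * c) = 1 by rewrite w'E mulVf//= expr1n expr0n addr0 sqrtr1.
  rewrite Normc.normcM normc_conjc rE => /(canRL (mulfK (lt0r_neq0 r0))) ->.
  by rewrite mul1r.
rewrite !tau_weight2E rE rV weight2V.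
(* The two equal roots multiply to the radicand, and r^(2m+2) / r^2 leaves r^(2m). *)
have hh : (Num.sqrt (weight2 m (rnorm z)))%:C * (Num.sqrt (weight2 m (rnorm z)))%:C *
    ((rnorm z ^+ 2)^-1)%:C =
    ((Num.sqrt pi)^-1)%:C * (radial_V m (rnorm z ^+ 2))%:C * (rnorm z)%:C ^+ m.*2.
  rewrite -!rmorphXn -!rmorphM -expr2 sqr_sqrtr ?weight2_ge0// weight2E//; last exact: ltW.
  congr (_%:C); rewrite -[m.*2.+2]addn2 exprD; field.
  by rewrite gt_eqF ?sqrtr_gt0 ?pi_gt0// gt_eqF.
have tE e : disc_wave e (a + b) m.*2 z = (radial_V m (rnorm z ^+ 2))%:C *
    ((rnorm z)%:C ^+ e * ((rnorm z)%:C)^-1 ^+ (a + b + m.*2) * (w ^+ (a + b) * c ^+ m.*2)).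
  rewrite /disc_wave -/w -/c powR_inv1 ?ltW// !rmorphM/= !rmorphXn/= fmorphV; ring.
rewrite !tE.
have w0' := wave_term a w0 c0 wc bm; have w1' := wave_term b w0 c0 wc am.
rewrite -w0' [(a + b)%N]addnC -w1'.
have wVX n : w' ^+ n = (c ^+ n)^-1 by rewrite w'E exprVn.
rewrite !wVX invrK.
set h := (Num.sqrt (weight2 m _))%:C in hh *; set s2 := (_^-1)%:C in hh *.
transitivity (w ^- m * c ^+ m * (h * h * s2) * (w ^+ a / c ^+ b - w ^+ b / c ^+ a)).
  by ring.
rewrite hh; ring.
Qed.

Lemma skew_betaE (p q : {poly R[i]}) :
  (size p <= m.*2.+1)%N -> (size q <= m.*2.+1)%N ->
  skew_beta m.*2.+1 p q =
  \sum_(a < m.*2.+1) \sum_(b < m.*2.+1) p`_a * q`_b * beta_kernel a b.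
Proof.
move=> sp sq; rewrite /skew_beta.
have mD := @measurable_disc R.
pose F (a b : 'I_m.*2.+1) (z : R * R) : R[i] :=
  (p`_a * q`_b * ((Num.sqrt pi)^-1)%:C) *
  (disc_wave (m.*2 + a - b) (a + b) m.*2 z + (-1) * disc_wave (m.*2 + b - a) (a + b) m.*2 z).
have iW e n l := (Cintegral_disc_wave e n l).1.
have iF a b : Cintegrable (mu \x mu)%E (@disc R) (F a b).
  by apply: CintegrableZ => //; apply: CintegrableD => //; exact: CintegrableZ.
transitivity (Cintegral (mu \x mu)%E (@disc R)
    (fun z => \sum_(a < m.*2.+1) \sum_(b < m.*2.+1) F a b z)).
  apply: eq_Cintegral => z zD.
  rewrite -[LHS]/(beta_weight z * (p.[cplx z] * q.[((cplx z)^*)^-1] - q.[cplx z] * p.[((cplx z)^*)^-1])).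
  rewrite !(horner_coef_wide _ sp) !(horner_coef_wide _ sq).
  set w := cplx z; set w' := (w^*)^-1.
  have -> : (\sum_(i < m.*2.+1) p`_i * w ^+ i) * (\sum_(i < m.*2.+1) q`_i * w' ^+ i) -
      (\sum_(i < m.*2.+1) q`_i * w ^+ i) * (\sum_(i < m.*2.+1) p`_i * w' ^+ i) =
      \sum_(a < m.*2.+1) \sum_(b < m.*2.+1) p`_a * q`_b * (w ^+ a * w' ^+ b - w ^+ b * w' ^+ a).
    rewrite [X in _ - X]mulrC !mulr_suml -sumrB; apply: eq_bigr => a _.
    rewrite !mulr_sumr -sumrB; apply: eq_bigr => b _; ring.
  rewrite mulr_sumr; apply: eq_bigr => a _; rewrite mulr_sumr; apply: eq_bigr => b _.
  have am : (a <= m.*2)%N by rewrite -ltnS.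
  have bm : (b <= m.*2)%N by rewrite -ltnS.
  by rewrite mulrCA (beta_weightE zD am bm) /F mulN1r mulrA.
rewrite Cintegral_sum//; last by move=> a; exact: Cintegrable_sum.
apply: eq_bigr => a _; rewrite Cintegral_sum//; apply: eq_bigr => b _.
rewrite CintegralZ//; last by apply: CintegrableD => //; exact: CintegrableZ.
rewrite CintegralD//; last exact: CintegrableZ.
rewrite CintegralZ// !(Cintegral_disc_wave _ _ _).2 /beta_kernel.
ring.
Qed.

Lemma beta_kernelC (a b : nat) : beta_kernel a b = - beta_kernel b a.
Proof. by rewrite /beta_kernel [(b + a)%N]addnC; ring. Qed.

Lemma beta_kernel_eq0 (a b : nat) : (a + b)%N != m.*2 -> beta_kernel a b = 0.
Proof. by move=> /negbTE abm; rewrite /beta_kernel abm mul0r mulr0. Qed.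

Lemma beta_kernelE (a b : nat) : (a + b)%N = m.*2 -> a != m ->
  beta_kernel a b = (Num.sqrt pi * (beta_sum R a b - beta_sum R m m) / (m%:R - a%:R))%:C.
Proof.
move=> abm am; rewrite /beta_kernel abm eqxx mul1r.
have -> : (m.*2 + a - b)%N = a.*2 by lia.
have -> : (m.*2 + b - a)%N = b.*2 by lia.
rewrite -rmorphB -rmorphM -mulrBr radial_momentB//; congr (_%:C).
have k0 : a%:R - m%:R != 0 :> R by rewrite subr_eq0 eqr_nat.
have k1 : m%:R - a%:R != 0 :> R by rewrite -oppr_eq0 opprB.
have sp : Num.sqrt pi != 0 :> R by rewrite gt_eqF// sqrtr_gt0 pi_gt0.
rewrite -[in 2 * pi](@sqr_sqrtr _ pi) ?pi_ge0//.
by field; rewrite k0 k1 sp.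
Qed.

End SkewBeta.

(** * Skew-orthogonality *)

Section SkewOrthogonality.
Variable R : realType.
Variable m : nat.

Definition skew_kernel (a b : nat) : R[i] := alpha_kernel R m a b + beta_kernel R m a b.

Definition skew_form (p q : {poly R[i]}) : R[i] :=
  \sum_(a < m.*2.+1) \sum_(b < m.*2.+1) p`_a * q`_b * skew_kernel a b.

Lemma skew_SE (p q : {poly R[i]}) :
  (size p <= m.*2.+1)%N -> (size q <= m.*2.+1)%N ->
  skew_S m.*2.+1 p q = skew_form p q.
Proof.
move=> sp sq; rewrite /skew_S skew_alphaE// skew_betaE// -big_split.
apply: eq_bigr => a _; rewrite -big_split; apply: eq_bigr => b _.
by rewrite /skew_kernel mulrDr.
Qed.

Lemma skew_kernelC a b : skew_kernel a b = - skew_kernel b a.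
Proof. by rewrite /skew_kernel alpha_kernelC beta_kernelC opprD. Qed.

Lemma skew_kernel_eq0 a b : a != m -> b != m -> (a + b)%N != m.*2 -> skew_kernel a b = 0.
Proof. by move=> am bm abm; rewrite /skew_kernel alpha_kernel_eq0// beta_kernel_eq0// addr0. Qed.

Lemma skew_kernelE a b : (a + b)%N = m.*2 -> a != m ->
  skew_kernel a b = (Num.sqrt pi * beta_sum R a b / (m%:R - a%:R))%:C.
Proof.
move=> abm am; rewrite /skew_kernel alpha_kernelE// beta_kernelE// -rmorphD.
by congr (_%:C); ring.
Qed.

Lemma skew_kernel_neq0 a b : (a + b)%N = m.*2 -> a != m -> skew_kernel a b != 0.
Proof.
move=> abm am; rewrite skew_kernelE//.
suff : Num.sqrt pi * beta_sum R a b / (m%:R - a%:R) != 0.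
  by move=> h; rewrite eq_complex /= negb_and h.
have k0 : m%:R - a%:R != 0 :> R by rewrite subr_eq0 eqr_nat eq_sym.
rewrite !mulf_neq0 ?invr_eq0// ?gt_eqF ?sqrtr_gt0 ?pi_gt0// beta_sumE.
by rewrite divr_gt0 ?mulr_gt0 ?exprn_gt0 ?ltr0n ?muln_gt0 ?fact_gt0.
Qed.

Lemma skew_formC p q : skew_form p q = - skew_form q p.
Proof.
rewrite /skew_form exchange_big -sumrN; apply: eq_bigr => a _.
rewrite -sumrN; apply: eq_bigr => b _; rewrite skew_kernelC; ring.
Qed.

Lemma skew_form_self p : skew_form p p = 0.
Proof.
have /eqP := skew_formC p p; rewrite -addr_eq0 -mulr2n -mulr_natr mulf_eq0 pnatr_eq0 orbF.
by move/eqP.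
Qed.

Lemma skew_formDl p1 p2 q : skew_form (p1 + p2) q = skew_form p1 q + skew_form p2 q.
Proof.
rewrite /skew_form -big_split; apply: eq_bigr => a _; rewrite -big_split.
by apply: eq_bigr => b _; rewrite coefD !mulrDl.
Qed.

Lemma skew_formZl c p q : skew_form (c *: p) q = c * skew_form p q.
Proof.
rewrite /skew_form mulr_sumr; apply: eq_bigr => a _; rewrite mulr_sumr.
by apply: eq_bigr => b _; rewrite coefZ; ring.
Qed.

Lemma skew_form0l q : skew_form 0 q = 0.
Proof. by rewrite -(scale0r 0) skew_formZl mul0r. Qed.

Lemma skew_form_suml (n : nat) (F : 'I_n -> {poly R[i]}) q :
  skew_form (\sum_(i < n) F i) q = \sum_(i < n) skew_form (F i) q.
Proof.
elim: n F => [|n IH] F; first by rewrite !big_ord0 skew_form0l.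
by rewrite !big_ord_recr skew_formDl IH.
Qed.

(** The kernel is arbitrary so that the circle, disc and combined products are all covered. *)
Lemma bilinear_XX (W : nat -> nat -> R[i]) a b : (a <= m.*2)%N -> (b <= m.*2)%N ->
  \sum_(i < m.*2.+1) \sum_(j < m.*2.+1)
    ('X^a : {poly R[i]})`_i * ('X^b : {poly R[i]})`_j * W i j = W a b.
Proof.
move=> am' bm'; have am : (a < m.*2.+1)%N by [].
have bm : (b < m.*2.+1)%N by [].
rewrite (bigD1 (Ordinal am))//= [X in _ + X]big1 ?addr0; last first.
  move=> i ia; rewrite big1// => j _; rewrite !coefXn.
  have -> : (val i == a) = false by apply/negbTE.
  by rewrite !mul0r.
rewrite (bigD1 (Ordinal bm))//= [X in _ + X]big1 ?addr0; last first.
  move=> j jb; rewrite !coefXn.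
  have -> : (val j == b) = false by apply/negbTE.
  by rewrite mulr0 mul0r.
by rewrite !coefXn !eqxx !mul1r.
Qed.

Lemma skew_formXX a b : (a <= m.*2)%N -> (b <= m.*2)%N ->
  skew_form 'X^a 'X^b = skew_kernel a b.
Proof. exact: bilinear_XX. Qed.

(* The exponent of x in q_(2j). *)
Definition qexp (j : nat) : nat := if (j.*2 < m)%N then j.*2 else j.*2.+1.

Lemma qexp_le j : (j < m)%N -> (qexp j <= m.*2)%N.
Proof. by rewrite /qexp; case: ifP; lia. Qed.

(** In the first range 2j < m, in the second 2j + 1 > m: the shift by one exists to step over m. *)
Lemma qexp_neq j : qexp j != m.
Proof. by rewrite /qexp; case: ifP; lia. Qed.

Lemma qexpC_neq j : (j < m)%N -> (m.*2 - qexp j)%N != m.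
Proof. by move=> jm; have := qexp_neq j; have := qexp_le jm; lia. Qed.

(** Two exponents below m have sum less than 2m, and two above m have sum greater than 2m. In the
    mixed case one is even and the other odd, so the sum is odd. *)
Lemma qexp_addn j l : (j < m)%N -> (l < m)%N -> (qexp j + qexp l)%N != m.*2.
Proof. by rewrite /qexp; case: ifP; case: ifP; lia. Qed.

Lemma qexp_inj j l : (qexp j == qexp l) = (j == l).
Proof. by rewrite /qexp; case: ifP; case: ifP; lia. Qed.

Lemma qmon_even j : qmon R m.*2.+1 j.*2 = 'X^(qexp j).
Proof. by rewrite /qmon /= odd_double !doubleK. Qed.

Lemma qmon_odd j : qmon R m.*2.+1 j.*2.+1 = 'X^(m.*2 - qexp j).
Proof. by rewrite /qmon /= odd_double /= uphalf_double doubleK. Qed.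

Lemma q_even j : (j < m)%N -> q_ R m.*2.+1 j.*2 = 'X^(qexp j).
Proof. by move=> jm; rewrite /q_ /= ltn_double jm qmon_even. Qed.

Lemma q_odd j : (j < m)%N -> q_ R m.*2.+1 j.*2.+1 = 'X^(m.*2 - qexp j).
Proof. by move=> jm; rewrite /q_ /= ifT ?qmon_odd//; lia. Qed.

Lemma alphahatE j : (j < m)%N ->
  alphahat R m.*2.+1 j = alpha_kernel R m (qexp j) (m.*2 - qexp j).
Proof.
move=> jm; have ja := qexp_le jm.
by rewrite /alphahat qmon_even qmon_odd skew_alphaE ?size_polyXn ?ltnS ?leq_subr// bilinear_XX ?leq_subr.
Qed.

Lemma betahatE j : (j < m)%N ->
  betahat R m.*2.+1 j = beta_kernel R m (qexp j) (m.*2 - qexp j).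
Proof.
move=> jm; have ja := qexp_le jm.
by rewrite /betahat qmon_even qmon_odd skew_betaE ?size_polyXn ?ltnS ?leq_subr// bilinear_XX ?leq_subr.
Qed.

Lemma skew_SXX a b : (a <= m.*2)%N -> (b <= m.*2)%N ->
  skew_S m.*2.+1 'X^a 'X^b = skew_kernel a b.
Proof. by move=> am bm; rewrite skew_SE ?size_polyXn// skew_formXX. Qed.

Definition pair_norm (j : nat) : R[i] := skew_kernel (qexp j) (m.*2 - qexp j).

Lemma alphabetahatE j : (j < m)%N ->
  alphahat R m.*2.+1 j + betahat R m.*2.+1 j = pair_norm j.
Proof.
move=> jm; rewrite -[LHS]/(skew_S _ _ _) qmon_even qmon_odd skew_SXX ?leq_subr//.
exact: qexp_le.
Qed.

Lemma pair_norm_neq0 j : (j < m)%N -> pair_norm j != 0.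
Proof. by move=> jm; rewrite skew_kernel_neq0 ?qexp_neq// subnKC// qexp_le. Qed.

Lemma skew_kernel_ee j l : (j < m)%N -> (l < m)%N -> skew_kernel (qexp j) (qexp l) = 0.
Proof. by move=> jm lm; rewrite skew_kernel_eq0 ?qexp_neq// qexp_addn. Qed.

Lemma skew_kernel_oo j l : (j < m)%N -> (l < m)%N ->
  skew_kernel (m.*2 - qexp j) (m.*2 - qexp l) = 0.
Proof.
move=> jm lm; rewrite skew_kernel_eq0 ?qexpC_neq//.
by have := qexp_addn jm lm; have := qexp_le jm; have := qexp_le lm; lia.
Qed.

Lemma skew_kernel_eo j l : (j < m)%N -> (l < m)%N ->
  skew_kernel (qexp j) (m.*2 - qexp l) = (j == l)%:R * pair_norm j.
Proof.
move=> jm lm; case: eqVneq => [->|jl]; first by rewrite mul1r.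
rewrite mul0r skew_kernel_eq0 ?qexp_neq ?qexpC_neq//.
have : qexp j != qexp l by rewrite qexp_inj.
by have := qexp_le jm; have := qexp_le lm; lia.
Qed.

Lemma qlastE : qlast R m.*2.+1 = 'X^m + \sum_(j < m)
  ((skew_kernel (m.*2 - qexp j) m / pair_norm j) *: 'X^(qexp j) +
   (- (skew_kernel (qexp j) m / pair_norm j)) *: 'X^(m.*2 - qexp j)).
Proof.
rewrite /qlast /= doubleK; congr (_ + _); apply: eq_bigr => j _.
have mm : (m <= m.*2)%N by lia.
by rewrite qmon_even qmon_odd alphabetahatE// !skew_SXX ?leq_subr ?qexp_le// scaleNr.
Qed.

Lemma size_qlast : (size (qlast R m.*2.+1) <= m.*2.+1)%N.
Proof.
have sX (c : R[i]) a : (a <= m.*2)%N -> (size (c *: 'X^a) <= m.*2.+1)%N.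
  by move=> am; rewrite (leq_trans (size_scale_leq _ _))// size_polyXn.
rewrite qlastE (leq_trans (size_polyD _ _))// geq_max size_polyXn.
apply/andP; split; first by lia.
apply: (leq_trans (size_sum _ _ _)); apply/bigmax_leqP => j _.
rewrite (leq_trans (size_polyD _ _))// geq_max !sX ?leq_subr//.
exact: qexp_le.
Qed.

(** No correction monomial has exponent m, so the corrections leave the circle integral of q_(N-1)
    unchanged. *)
Lemma coef_qlast : (qlast R m.*2.+1)`_m = 1.
Proof.
rewrite qlastE coefD coefXn eqxx coef_sum big1 ?addr0// => j _.
by rewrite coefD !coefZ !coefXn ![m == _]eq_sym (negbTE (qexp_neq j)) (negbTE (qexpC_neq (ltn_ord j))) !mulr0 addr0.
Qed.

Lemma skew_form_qlast_mon (c : nat) : (c <= m.*2)%N ->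
  skew_form (qlast R m.*2.+1) 'X^c = skew_kernel m c + \sum_(j < m)
  (skew_kernel (m.*2 - qexp j) m / pair_norm j * skew_kernel (qexp j) c -
   skew_kernel (qexp j) m / pair_norm j * skew_kernel (m.*2 - qexp j) c).
Proof.
move=> cm; rewrite qlastE skew_formDl skew_form_suml skew_formXX//; last by lia.
congr (_ + _); apply: eq_bigr => j _.
by rewrite skew_formDl !skew_formZl !skew_formXX ?leq_subr ?qexp_le// mulNr.
Qed.

(** Among the corrections only the partner x^(2m - qexp l) pairs with x^(qexp l), and its
    coefficient is chosen to cancel the pairing with x^m. *)
Lemma skew_form_qlast_even l : (l < m)%N -> skew_form (qlast R m.*2.+1) 'X^(qexp l) = 0.
Proof.
move=> lm; rewrite skew_form_qlast_mon ?qexp_le//.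
rewrite (bigD1 (Ordinal lm))//= big1 ?addr0; last first.
  move=> j jl; rewrite skew_kernel_ee// mulr0 sub0r skew_kernelC.
  rewrite [skew_kernel (_ - _) _]skew_kernelC skew_kernel_eo//.
  by rewrite eq_sym (negbTE (_ : val j != l)) ?mul0r ?oppr0 ?mulr0 ?oppr0.
rewrite skew_kernel_ee// mulr0 sub0r [skew_kernel (_ - _) _]skew_kernelC skew_kernel_eo//.
rewrite eqxx mul1r mulrN opprK divfK ?pair_norm_neq0//.
by rewrite skew_kernelC addNr.
Qed.

Lemma skew_form_qlast_odd l : (l < m)%N -> skew_form (qlast R m.*2.+1) 'X^(m.*2 - qexp l) = 0.
Proof.
move=> lm; rewrite skew_form_qlast_mon ?leq_subr//.
rewrite (bigD1 (Ordinal lm))//= big1 ?addr0; last first.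
  move=> j jl; rewrite skew_kernel_oo// mulr0 subr0 skew_kernel_eo//.
  by rewrite (negbTE (_ : val j != l)) ?mul0r ?mulr0.
rewrite skew_kernel_oo// mulr0 subr0 skew_kernel_eo// eqxx mul1r divfK ?pair_norm_neq0//.
by rewrite skew_kernelC addNr.
Qed.

Lemma nubarE : nubar R m.*2.+1 =
  (pi * Num.sqrt (Gamma (((m.*2.+1)%:R + 1) / 2) / Gamma ((m.*2.+1)%:R / 2 + 1)))%:C.
Proof.
rewrite /nubar q_last Cintegral_tau_horner ?size_qlast// coef_qlast mul1r -rmorphM.
congr (_%:C); rewrite Gamma_ratio /circle_weight weight2_1.
have p0 : 0 < Num.sqrt pi :> R by rewrite sqrtr_gt0 pi_gt0.
have S0 : 0 <= beta_sum R m m by rewrite beta_sumE divr_ge0 ?mulr_ge0 ?exprn_ge0.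
have -> : (Num.sqrt pi)^-1 * (beta_sum R m m / 2) = beta_sum R m m / Num.sqrt pi * 2^-1.
  by ring.
set X := beta_sum R m m / _.
have -> : Num.sqrt (X * 2^-1) = Num.sqrt X / Num.sqrt 2.
  by rewrite sqrtrM ?sqrtrV// divr_ge0// ltW.
have s2 : Num.sqrt 2 != 0 :> R by rewrite gt_eqF// sqrtr_gt0.
(* One factor 1 / sqrt 2 comes from the definition of [nubar], the other from [weight2_1]; together
   they halve 2 pi. *)
rewrite -[in 2 * pi](@sqr_sqrtr _ (2 : R))//; field.
exact: s2.
Qed.

End SkewOrthogonality.

(** * Gamma-function values of the circle and disc norms *)

Section HatValues.
Variables (R : realType) (m j : nat).
Hypothesis jm : (j < m)%N.

Let neq_qexp : m%:R - (qexp m j)%:R != 0 :> R.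
Proof. by rewrite subr_eq0 eqr_nat eq_sym qexp_neq. Qed.

Let sqrtpi_neq0 : Num.sqrt pi != 0 :> R.
Proof. by rewrite gt_eqF// sqrtr_gt0 pi_gt0. Qed.

(** Expressed through [qexp m j], one formula covers both ranges of j. *)
Lemma alphahat_Gamma : alphahat R m.*2.+1 j =
  (pi / (m%:R - (qexp m j)%:R) *
   (Gamma (((m.*2.+1)%:R + 1) / 2) / Gamma ((m.*2.+1)%:R / 2 + 1)) : R)%:C.
Proof.
rewrite alphahatE// alpha_kernelE ?qexp_neq ?subnKC ?qexp_le//; congr (_%:C).
rewrite Gamma_ratio; move: sqrtpi_neq0 (sqr_sqrtr (pi_ge0 R)).
by move: (Num.sqrt pi) => s s0 <-; field; rewrite s0 neq_qexp.
Qed.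

Lemma betahat_Gamma : betahat R m.*2.+1 j =
  (Num.sqrt pi / (m%:R - (qexp m j)%:R) *
   (2 ^+ m.*2.+1 * (Gamma ((qexp m j)%:R + 1) * Gamma ((m.*2 - qexp m j)%:R + 1)
                      / Gamma (m.*2.+1%:R + 1))
    - Num.sqrt pi * (Gamma (((m.*2.+1)%:R + 1) / 2) / Gamma ((m.*2.+1)%:R / 2 + 1)))
   : R)%:C.
Proof.
have qm := qexp_le jm.
rewrite betahatE// beta_kernelE ?qexp_neq ?subnKC//; congr (_%:C).
rewrite Gamma_ratio !GammaS beta_sumE subnKC// natrM.
have f0 : m.*2.+1`!%:R != 0 :> R by rewrite pnatr_eq0 -lt0n fact_gt0.
by field; rewrite sqrtpi_neq0 neq_qexp f0.
Qed.

End HatValues.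

Theorem proposition6p14 (R : realType) (N : nat) (oddN : odd N) :
  (forall j l : nat, (j < (N.-1)./2)%N -> (l < (N.-1)./2)%N ->
    [/\ skew_S N (q_ R N j.*2) (q_ R N l.*2) = 0,
        skew_S N (q_ R N j.*2.+1) (q_ R N l.*2.+1) = 0,
        skew_S N (q_ R N j.*2) (q_ R N l.*2.+1) =
          - skew_S N (q_ R N l.*2.+1) (q_ R N j.*2)
      & skew_S N (q_ R N j.*2) (q_ R N l.*2.+1) =
          (j == l)%:R * (alphahat R N j + betahat R N j)]) /\
  (forall s : nat, (1 <= s <= N)%N ->
    skew_S N (q_ R N (s - 1)) (q_ R N (N - 1)) = 0 /\
    skew_S N (q_ R N (N - 1)) (q_ R N (s - 1)) = 0) /\
  (forall j : nat, (j.*2 < (N.-1)./2)%N ->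
    alphahat R N j =
      (2 * pi / (N%:R - 1 - 4 * j%:R) *
       (Gamma ((N%:R + 1) / 2) / Gamma (N%:R / 2 + 1)) : R)%:C /\
    betahat R N j =
      (2 * Num.sqrt pi / (N%:R - 1 - 4 * j%:R) *
       (2 ^+ N * (Gamma (2 * j%:R + 1) * Gamma (N%:R - 2 * j%:R)
                    / Gamma (N%:R + 1))
        - Num.sqrt pi * (Gamma ((N%:R + 1) / 2) / Gamma (N%:R / 2 + 1)))
       : R)%:C) /\
  (forall j : nat, ((N.-1)./2 <= j.*2 < N.-1)%N ->
    alphahat R N j =
      (2 * pi / (N%:R - 3 - 4 * j%:R) *
       (Gamma ((N%:R + 1) / 2) / Gamma (N%:R / 2 + 1)) : R)%:C /\
    betahat R N j =
      (2 * Num.sqrt pi / (N%:R - 3 - 4 * j%:R) *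
       (2 ^+ N * (Gamma (2 * j%:R + 2) * Gamma (N%:R - 2 * j%:R - 1)
                    / Gamma (N%:R + 1))
        - Num.sqrt pi * (Gamma ((N%:R + 1) / 2) / Gamma (N%:R / 2 + 1)))
       : R)%:C) /\
  nubar R N =
    (pi * Num.sqrt (Gamma ((N%:R + 1) / 2) / Gamma (N%:R / 2 + 1)) : R)%:C.
Proof.
have [m ->] : exists m, N = m.*2.+1.
  by exists N./2; rewrite -[LHS]odd_double_half oddN.
rewrite [m.*2.+1.-1]/= doubleK.
split; [|split; [|split; [|split]]].
- move=> j l jm lm; rewrite !q_even// !q_odd// alphabetahatE// !skew_SXX ?leq_subr ?qexp_le//.
  rewrite skew_kernel_ee// skew_kernel_oo//; split=> //; first exact: skew_kernelC.
  exact: skew_kernel_eo.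
- move=> s /andP[s1 sN]; rewrite subSS subn0 q_last.
  (* By antisymmetry one order of the arguments suffices; the size bound permits passing to
     [skew_form]. *)
  suff : skew_S m.*2.+1 (qlast R m.*2.+1) (q_ R m.*2.+1 (s - 1)) = 0 /\
         (size (q_ R m.*2.+1 (s - 1)) <= m.*2.+1)%N.
    move=> [h sz]; split=> //; move: h; rewrite !skew_SE ?size_qlast// skew_formC.
    by move=> /eqP; rewrite oppr_eq0 => /eqP.
  (* For s = N both arguments are q_(N-1). Otherwise s - 1 < 2m is the index of a monomial, even or
     odd. *)
  have [->|sm] := eqVneq (s - 1)%N m.*2.
    by rewrite q_last skew_SE ?size_qlast// skew_form_self.
  have lm : ((s - 1)./2 < m)%N by lia.
  rewrite -[(s - 1)%N]odd_double_half; case: (odd _) => /=.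
    rewrite add1n q_odd// size_polyXn ltnS leq_subr skew_SE ?size_qlast ?size_polyXn ?ltnS ?leq_subr//.
    by rewrite skew_form_qlast_odd.
  rewrite add0n q_even// size_polyXn ltnS qexp_le// skew_SE ?size_qlast ?size_polyXn ?ltnS ?qexp_le//.
  by rewrite skew_form_qlast_even.
- move=> j jm; have jm' : (j < m)%N by lia.
  rewrite alphahat_Gamma// betahat_Gamma// /qexp jm.
  have j0 : m%:R - j.*2%:R != 0 :> R by rewrite subr_eq0 eqr_nat gt_eqF.
  (* The denominator is twice m - qexp j, which absorbs the factor 2 of the numerator. *)
  have e1 : m.*2.+1%:R - 1 - 4 * j%:R = 2 * (m%:R - j.*2%:R) :> R.
    by rewrite -natr1 -!muln2 !natrM; ring.
  have e2 : 2 * j%:R + 1 = j.*2%:R + 1 :> R by rewrite -muln2 natrM; ring.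
  have e3 : m.*2.+1%:R - 2 * j%:R = (m.*2 - j.*2)%:R + 1 :> R.
    by rewrite natrB; [rewrite -natr1 -!muln2 !natrM; ring|lia].
  rewrite e1 e2 e3; move: (m%:R - _) j0 => d d0.
  by split; congr (_%:C); congr (_ * _); field.
- move=> j /andP[mj jm2]; have jm : (j < m)%N by lia.
  rewrite alphahat_Gamma// betahat_Gamma// /qexp ltnNge mj [~~ true]/=.
  have j0 : m%:R - j.*2.+1%:R != 0 :> R by rewrite subr_eq0 eqr_nat lt_eqF.
  (* The 3 in place of 1 reflects the exponent 2j + 1 of the upper range. *)
  have e1 : m.*2.+1%:R - 3 - 4 * j%:R = 2 * (m%:R - j.*2.+1%:R) :> R.
    by rewrite -[m.*2.+1%:R]natr1 -[j.*2.+1%:R]natr1 -!muln2 !natrM; ring.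
  have e2 : 2 * j%:R + 2 = j.*2.+1%:R + 1 :> R.
    by rewrite -[j.*2.+1%:R]natr1 -muln2 natrM; ring.
  have e3 : m.*2.+1%:R - 2 * j%:R - 1 = (m.*2 - j.*2.+1)%:R + 1 :> R.
    by rewrite natrB; [rewrite -[m.*2.+1%:R]natr1 -[j.*2.+1%:R]natr1 -!muln2 !natrM; ring|lia].
  rewrite e1 e2 e3; move: (m%:R - _) j0 => d d0.
  by split; congr (_%:C); congr (_ * _); field.
- exact: nubarE.
Qed.
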